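(* Let $G$ be a graph with at least one edge such that the edge ideal $I(G)$ is $k$-steps linear for some integer $k \geq 1$, and let $d$ be the maximum degree of a vertex in $G$. Then \[ \operatorname{reg}(I(G)) \leq \log_{\frac{k+4}{2}}\left(\frac{d}{k+1}\right) +3. \]
   Context: All graphs are finite and simple. Let $K$ be a fixed field and let $S$ be the polynomial ring over $K$ whose variables are the vertices of $G$ (standard graded). The edge ideal of $G$ is $I(G) = (xy : (x,y) \text{ is an edge of } G)\subset S$. The Castelnuovo–Mumford regularity of a graded $S$-module $M$ is $\operatorname{reg}(M)=\max\{\,j-m : \operatorname{Tor}^S_m(M,K)_j\neq 0\,\}$. The ideal $I(G)$ is called $k$-steps linear if $\operatorname{Tor}_i^S(I(G),K)_j=0$ for all $1\le i\le k$ and all $j\ne i+2$.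
   Formalization: Adds the hypothesis that k ≤ 2 or d ≥ 2: for d = 1 and k ≥ 3 the claim is false (for a single edge I(G) = (xy) is k-steps linear for all k with regularity 2, but the bound is below 2, e.g. about 1.893 for k = 3). *)

(* Defs.v *)
From HB Require Import structures.
From mathcomp Require Import all_boot all_order all_algebra.
From mathcomp Require Import mpoly ring.

Set Implicit Arguments.
Unset Strict Implicit.
Unset Printing Implicit Defensive.

Import GRing.Theory.
Local Open Scope ring_scope.

Section FreeResolution.
Variables (n : nat) (K : fieldType).
Local Notation S := {mpoly K[n]}.

(* p lies in the degree-j component of the twisted free module S(-d). *)
Definition in_twist (d j : nat) (p : S) : bool :=
  if (d <= j)%N then p \is (j - d).-homog else p == 0.

(* The map of free modules sending e_a to \sum_b D a b * e_b. *)
Definition free_map (A B : finType) (D : A -> B -> S) (v : A -> S) : B -> S :=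
  fun b => \sum_a v a * D a b.

(* A graded free resolution of K = S / (all variables) by the finite free
   modules F_m = \bigoplus_(a : gens m) S(- gdeg a).  The augmentation F_0 -> K
   sends e_b to [aug b]; a scalar p : S acts on K through its constant
   coefficient p@_0. *)
Record free_resolution := FreeResolution {
  gens : nat -> finType;
  gdeg : forall m, gens m -> nat;
  diff : forall m, gens m.+1 -> gens m -> S;
  aug : gens 0 -> K;
  diff_graded : forall m (a : gens m.+1) (b : gens m),
    in_twist (gdeg b) (gdeg a) (diff a b);
  aug_graded : forall b, aug b != 0 -> gdeg b = 0%N;
  diff_diff : forall m (v : gens m.+2 -> S) c,
    free_map (@diff m) (free_map (@diff m.+1) v) c = 0;
  aug_diff : forall v : gens 1 -> S,
    \sum_b (free_map (@diff 0) v b)@_0%MM * aug b = 0;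
  diff_exact : forall m (v : gens m.+1 -> S),
    (forall b, free_map (@diff m) v b = 0) ->
    exists u : gens m.+2 -> S, v =1 free_map (@diff m.+1) u;
  aug_exact : forall v : gens 0 -> S,
    \sum_b (v b)@_0%MM * aug b = 0 ->
    exists u : gens 1 -> S, v =1 free_map (@diff 0) u;
  aug_surjective : exists b, aug b != 0 }.

(* For an ideal M of S, the module M \otimes_S F_m is the direct sum of copies
   of M indexed by [gens F m]. *)
Section Homology.
Variables (F : free_resolution) (M : S -> Prop).

Definition tensor_chain (m j : nat) (v : gens F m -> S) : Prop :=
  forall a, M (v a) /\ in_twist (gdeg a) j (v a).

Definition tensor_cycle (m : nat) : (gens F m -> S) -> Prop :=
  match m with
  | 0 => fun _ => True
  | m'.+1 => fun v => forall b, free_map (@diff F m') v b = 0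
  end.

Definition tensor_boundary (m j : nat) (v : gens F m -> S) : Prop :=
  exists u : gens F m.+1 -> S,
    tensor_chain j u /\ v =1 free_map (@diff F m) u.

Definition homology_vanishes (m j : nat) : Prop :=
  forall v : gens F m -> S,
    tensor_chain j v -> tensor_cycle v -> tensor_boundary j v.

End Homology.
End FreeResolution.

Section Koszul.
Variables (n : nat) (K : fieldType).
Local Notation S := {mpoly K[n]}.
Implicit Types (i a : 'I_n) (p q : S) (A B : {set 'I_n}) (f g : {set 'I_n} -> S).

Definition ksign a B : S := (-1) ^+ #|[set b in B | (b < a)%N]|.

Definition kgens (m : nat) : finType := {A : {set 'I_n} | #|A| == m}.

(* The usual Koszul differential: e_A is sent to
   \sum_(a in A) (+/-) x_a e_(A - a). *)
Definition kdiff (m : nat) (A : kgens m.+1) (B : kgens m) : S :=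
  \sum_(a in val A | val A :\ a == val B) ksign a (val B) * 'X_a.

(* Exactness of the Koszul complex: working with all exterior degrees at once,
   for each variable x_i division by x_i gives a homotopy between the identity
   and the projection [kproj i] killing e_A for i in A and setting x_i = 0. *)

Definition kd f B : S := \sum_(a | a \notin B) ksign a B * 'X_a * f (a |: B).

Definition mquo i p : S :=
  \sum_(m <- msupp p | (0 < m i)%N) p@_m *: 'X_[m - U_(i)].

Lemma subUK (m : 'X_{1..n}) i : (0 < m i)%N -> (m - U_(i) + U_(i))%MM = m.
Proof.
move=> mi; apply/mnmP=> a; rewrite mnmDE mnmBE mnm1E.
by case: eqP => [<-|_]; rewrite ?subnK ?subn0 ?addn0.
Qed.

Lemma coefX i p m :
  ('X_i * p)@_m = if (0 < m i)%N then p@_(m - U_(i)) else 0.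
Proof.
rewrite mulrC; case: ifP => [mi|/negbT]; first by rewrite -{1}(subUK mi) addmC mcoeffMX.
rewrite -eqn0Ngt => /eqP mi; rewrite (mpolyE p) mulr_suml raddf_sum /=.
rewrite big1 // => k _; rewrite -scalerAl -mpolyXD mcoeffZ mcoeffX.
case: eqP => [E|_]; last by rewrite mulr0.
by move: mi; rewrite -E mnmDE mnm1E eqxx addn1.
Qed.

Lemma coef_mquo i p m : (mquo i p)@_m = p@_(m + U_(i)).
Proof.
rewrite /mquo raddf_sum /=.
transitivity (\sum_(k <- msupp p | k == (m + U_(i))%MM) p@_k).
  rewrite big_mkcond [RHS]big_mkcond; apply: eq_bigr => k _.
  rewrite mcoeffZ mcoeffX; case: ifP => ki.
    have -> : ((k - U_(i))%MM == m) = (k == (m + U_(i))%MM).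
      apply/eqP/eqP => [<-|->]; first by rewrite subUK.
      by rewrite addmK.
    by case: eqP; rewrite ?mulr1 ?mulr0.
  case: eqP => // E; move: ki; by rewrite E mnmDE mnm1E eqxx addn1.
rewrite -big_filter; case: (boolP ((m + U_(i))%MM \in msupp p)) => [mp|mp].
  by rewrite filter_pred1_uniq ?msupp_uniq // big_seq1.
rewrite (memN_msupp_eq0 mp) big_filter big1_seq // => k /andP[/eqP -> kp].
by rewrite kp in mp.
Qed.

Lemma mquoD i p q : mquo i (p + q) = mquo i p + mquo i q.
Proof. by apply/mpolyP=> m; rewrite mcoeffD !coef_mquo mcoeffD. Qed.

Lemma mquo0 i : mquo i 0 = 0.
Proof. by apply/mpolyP=> m; rewrite coef_mquo !mcoeff0. Qed.

Lemma mquo_sum (I : finType) (P : pred I) (F : I -> S) i :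
  mquo i (\sum_(k | P k) F k) = \sum_(k | P k) mquo i (F k).
Proof. by apply: big_morph; [exact: mquoD|exact: mquo0]. Qed.

Lemma mquo_sign i (k : nat) p : mquo i ((-1) ^+ k * p) = (-1) ^+ k * mquo i p.
Proof.
rewrite -signr_odd; case: (odd k); rewrite ?expr0 ?expr1 ?mul1r // !mulN1r.
by apply/mpolyP=> m; rewrite mcoeffN !coef_mquo mcoeffN.
Qed.

Lemma mquoXX i p : mquo i ('X_i * p) = p.
Proof.
apply/mpolyP=> m; rewrite coef_mquo coefX mnmDE mnm1E eqxx addn1 /=.
by rewrite addmK.
Qed.

Lemma mquoX i a p : a != i -> mquo i ('X_a * p) = 'X_a * mquo i p.
Proof.
move=> ai; apply/mpolyP=> m; rewrite coef_mquo !coefX mnmDE mnm1E.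
rewrite eq_sym (negbTE ai) addn0; case: ifP => // ma; rewrite coef_mquo.
congr (p@_ _); apply/mnmP=> b; rewrite !(mnmDE, mnmBE, mnm1E).
case: (i =P b) => [<-|_]; last by rewrite !addn0.
by rewrite (negbTE ai) !subn0.
Qed.

Definition mres i p : S := p - 'X_i * mquo i p.

Lemma coef_mres i p m : (mres i p)@_m = if m i == 0%N then p@_m else 0.
Proof.
rewrite mcoeffB coefX; case: (posnP (m i)) => [_|mi]; first by rewrite subr0.
by rewrite coef_mquo subUK // subrr.
Qed.

Definition khom i f A : S :=
  if i \in A then ksign i A * mquo i (f (A :\ i)) else 0.

Definition kproj i f A : S := if i \in A then 0 else mres i (f A).

Lemma ksignK a B : ksign a B * ksign a B = 1.
Proof. by rewrite /ksign -expr2 sqrr_sign. Qed.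

Lemma ksignU1 a i B : i \notin B ->
  ksign a (i |: B) = (-1) ^+ (i < a)%N * ksign a B.
Proof.
move=> iB; rewrite /ksign -exprD; congr (_ ^+ _).
case: (boolP (i < a)%N) => ia.
  have -> : [set b in i |: B | (b < a)%N] = i |: [set b in B | (b < a)%N].
    by apply/setP=> b; rewrite !inE; case: eqP => // ->; rewrite ia.
  by rewrite cardsU1 !inE (negbTE iB).
rewrite add0n; apply: eq_card => b; rewrite !inE.
by case: eqP => // ->; rewrite (negbTE ia) !andbF.
Qed.

Lemma ksign_swap a i B : a \notin B -> i \notin B -> a != i ->
  ksign a (i |: B) * ksign i B = - (ksign i (a |: B) * ksign a B).
Proof.
move=> aB iB ai; rewrite !ksignU1 // -!mulrA (mulrC (ksign a B)).
case: (ltngtP i a) => [_|_|/val_inj E]; rewrite ?expr0 ?expr1.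
- by rewrite mulN1r mul1r.
- by rewrite mulN1r mul1r opprK.
by rewrite E eqxx in ai.
Qed.

Lemma kd_kd f B : kd (kd f) B = 0.
Proof.
pose c a i := if [&& a \notin B, i \notin B & a != i] then
  ksign a B * 'X_a * (ksign i (a |: B) * 'X_i * f (i |: (a |: B))) else 0.
have cN a i : c a i = - c i a.
  rewrite /c [X in _ = - (if X then _ else _)]andbCA (eq_sym i); case: ifP => [/and3P[aB iB ai]|]; last by rewrite oppr0.
  rewrite setUCA; have := ksign_swap aB iB ai; move: (f _) => x h.
  transitivity (ksign i (a |: B) * ksign a B * ('X_a * 'X_i * x)); first by ring.
  transitivity (- (ksign a (i |: B) * ksign i B) * ('X_a * 'X_i * x)); last by ring.
  by rewrite h opprK.
have cd a : c a a = 0 by rewrite /c eqxx !andbF.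
transitivity (\sum_a \sum_i c a i).
  rewrite /kd [LHS]big_mkcond /=; apply: eq_bigr => a _.
  case: ifP => aB; last by rewrite big1 // => i _; rewrite /c aB.
  rewrite mulr_sumr big_mkcond; apply: eq_bigr => i _.
  by rewrite /c aB !inE negb_or eq_sym andbC; case: ifP.
transitivity (\sum_(p : 'I_n * 'I_n | (p.1 < p.2)%N) c p.1 p.2 +
              \sum_(p : 'I_n * 'I_n | (p.2 < p.1)%N) c p.1 p.2).
  rewrite pair_big /= (bigID (fun p : 'I_n * 'I_n => (p.1 < p.2)%N)) /=; congr (_ + _).
  rewrite (bigID (fun p : 'I_n * 'I_n => (p.2 < p.1)%N)) /= [X in _ + X]big1 ?addr0.
    by apply: eq_bigl => -[a i] /=; case: ltngtP.
  by move=> [a i] /=; case: (ltngtP a i) => // /val_inj -> _; rewrite cd.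
pose sw (p : 'I_n * 'I_n) := (p.2, p.1).
rewrite [X in _ + X](reindex sw) /=; last by exists sw => -[].
by rewrite -big_split big1 // => p _; rewrite /= (cN p.1) addNr.
Qed.

Lemma khomE i f B : kd (khom i f) B + khom i (kd f) B = f B - kproj i f B.
Proof.
rewrite /kproj /khom /kd; case: (boolP (i \in B)) => iB; last first.
  rewrite (bigD1 i) //= big1 ?addr0 => [|a /andP[aB ai]]; last first.
    by rewrite !inE eq_sym (negbTE ai) (negbTE iB) mulr0.
  rewrite setU11 setU1K // ksignU1 // ltnn expr0 mul1r /mres opprB addrCA subrr addr0.
  by rewrite mulrACA ksignK mul1r.
rewrite subr0 mquo_sum mulr_sumr.
rewrite [X in _ + X](bigD1 i) /=; last by rewrite !inE eqxx.
rewrite setD1K // -mulrA mquo_sign mquoXX mulrA.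
have sB : ksign i B = ksign i (B :\ i).
  by rewrite -{1}(setD1K iB) ksignU1 ?ltnn ?mul1r // !inE eqxx.
rewrite sB ksignK mul1r addrCA [X in _ + X](_ : _ = 0) ?addr0 //.
rewrite [X in _ + X](eq_bigl (fun a => a \notin B)); last first.
  move=> a; rewrite !inE negb_and negbK; case: eqP => [->|] /=; first by rewrite iB.
  by rewrite andbT.
rewrite -big_split big1 //= => a aB.
have ai : a != i by apply: contraNneq aB => ->.
have iD : i \notin B :\ i by rewrite !inE eqxx.
have aD : a \notin B :\ i by rewrite !inE (negbTE aB) andbF.
have E : (a |: B) :\ i = a |: (B :\ i).
  by apply/setP=> b; rewrite !inE; case: eqP => // ->; rewrite eq_sym (negbTE ai).
rewrite in_setU1 iB orbT E -(mulrA (ksign a (B :\ i))) mquo_sign mquoX //.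
have := ksign_swap aD iD ai; rewrite setD1K //.
have -> : ksign i (a |: B) = ksign i (a |: (B :\ i)).
  by rewrite -{1}(setD1K iB) setUCA ksignU1 ?ltnn ?mul1r // !inE negb_or eq_sym ai eqxx.
rewrite -sB; set x := 'X_a; set q := mquo _ _ => h.
transitivity (x * q * (ksign a B * ksign i (a |: B :\ i) +
                       ksign i B * ksign a (B :\ i))).
  by rewrite -/(ksign a (B :\ i)) /x /q; ring.
suff -> : ksign a B * ksign i (a |: B :\ i) = - (ksign i B * ksign a (B :\ i)).
  by rewrite addNr mulr0.
rewrite -[LHS]mulr1 -(ksignK i B) mulrACA h.
rewrite -[RHS]mul1r -(ksignK i (a |: B :\ i)); ring.
Qed.

Lemma kdB f g B : kd (fun A => f A - g A) B = kd f B - kd g B.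
Proof. by rewrite /kd -sumrB; apply: eq_bigr => a _; rewrite mulrBr. Qed.

Lemma kdD f g B : kd (fun A => f A + g A) B = kd f B + kd g B.
Proof. by rewrite /kd -big_split; apply: eq_bigr => a _; rewrite mulrDr. Qed.

Lemma eq_kd f g : f =1 g -> kd f =1 kd g.
Proof. by move=> fg B; apply: eq_bigr => a _; rewrite fg. Qed.

Lemma mresC i a p : mres i (mres a p) = mres a (mres i p).
Proof. by apply/mpolyP=> m; rewrite !coef_mres; case: (m i == 0%N); case: (m a == 0%N). Qed.

Lemma mres_id i p : mres i (mres i p) = mres i p.
Proof. by apply/mpolyP=> m; rewrite !coef_mres; case: (m i == 0%N). Qed.

Lemma mres0 i : mres i 0 = 0.
Proof. by rewrite /mres mquo0 mulr0 subr0. Qed.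

Lemma kd_cycle f (k : nat) : kd f =1 (fun=> 0) -> (k <= n)%N ->
  exists u g, [/\ forall B, f B = kd u B + g B, kd g =1 (fun=> 0),
    forall B i, (i < k)%N -> i \in B -> g B = 0 &
    forall B i, (i < k)%N -> mres i (g B) = g B].
Proof.
move=> f0; elim: k => [|k IH] kn.
  exists (fun=> 0), f; split=> // B; rewrite /kd big1 ?add0r // => a _.
  by rewrite mulr0.
have [u [g [fE g0 gB gr]]] := IH (ltnW kn); pose i := Ordinal kn.
have gE B : g B = kd (khom i g) B + kproj i g B.
  have := khomE i g B; rewrite {2}/khom.
  have -> : (if i \in B then ksign i B * mquo i (kd g (B :\ i)) else 0) = 0.
    by case: ifP => // _; rewrite g0 mquo0 mulr0.
  by rewrite addr0 => ->; rewrite subrK.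
exists (fun A => u A + khom i g A), (kproj i g); split.
- by move=> B; rewrite fE kdD gE addrA.
- move=> B; rewrite (eq_kd (g := fun A => g A - kd (khom i g) A)).
    by rewrite kdB g0 kd_kd subrr.
  by move=> A; rewrite gE addrAC subrr add0r.
- move=> B a; rewrite ltnS leq_eqVlt => /orP[/eqP ak|ak] aB; rewrite /kproj.
    by rewrite (_ : i = a) ?aB //; apply: val_inj.
  by case: ifP => // _; rewrite (gB _ _ ak aB) mres0.
- move=> B a; rewrite ltnS leq_eqVlt => /orP[/eqP ak|ak]; rewrite /kproj.
    by rewrite (_ : a = i); [case: ifP => _; rewrite ?mres0 ?mres_id|apply: val_inj].
  by case: ifP => _; rewrite ?mres0 // mresC gr.
Qed.

Lemma kd_exact f : kd f =1 (fun=> 0) -> (f set0)@_0%MM = 0 ->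
  exists u, f =1 kd u.
Proof.
move=> f0 fc; have [u [g [fE _ gB gr]]] := kd_cycle f0 (leqnn n).
exists u => B; rewrite fE [g B](_ : _ = 0) ?addr0 //.
case: (set_0Vmem B) => [->|[i iB]]; last exact: gB iB.
have c0 : (g set0)@_0%MM = 0.
  move: fc; rewrite fE mcoeffD raddf_sum big1 ?add0r //= => a _.
  by rewrite mulrAC mulrC coefX mnm0E.
apply/mpolyP=> m; rewrite mcoeff0.
case: (pickP (fun i => m i != 0%N)) => [i mi|m0].
  by rewrite -(gr set0 i) // coef_mres (negbTE mi).
rewrite (_ : m = 0%MM) //; apply/mnmP=> i; rewrite mnm0E.
by move/negbT: (m0 i); rewrite negbK => /eqP.
Qed.

Definition kext (m : nat) (v : kgens m -> S) A : S :=
  if insub A is Some a then v a else 0.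

Lemma kext_val m (v : kgens m -> S) (a : kgens m) : kext v (val a) = v a.
Proof. by rewrite /kext valK. Qed.

Lemma kext_out m (v : kgens m -> S) A : #|A| != m -> kext v A = 0.
Proof. by move=> Am; rewrite /kext insubN. Qed.

Lemma kd_ext m (v : kgens m.+1 -> S) (b : kgens m) :
  kd (kext v) (val b) = free_map (@kdiff m) v b.
Proof.
rewrite /free_map /kdiff /kd.
under [RHS]eq_bigr => a _ do rewrite mulr_sumr big_mkcond.
rewrite exchange_big [LHS]big_mkcond /=; apply: eq_bigr => i _.
case: (boolP (i \in val b)) => [ib|ib] /=.
  rewrite big1 // => a _; case: ifP => // /andP[_ /eqP/setP/(_ i)].
  by rewrite !inE eqxx ib.
have ibm : #|i |: val b| == m.+1 by rewrite cardsU1 ib (eqP (valP b)).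
rewrite (bigD1 (Sub (i |: val b) ibm : kgens m.+1)) //= big1 ?addr0.
  by rewrite setU11 setU1K // eqxx -(kext_val v) /= mulrC.
move=> a /eqP na; case: ifP => // /andP[ia /eqP E]; case: na.
by apply: val_inj; rewrite /= -E setD1K.
Qed.

Lemma kd_ext_out m (v : kgens m.+1 -> S) B : #|B| != m -> kd (kext v) B = 0.
Proof.
move=> Bm; rewrite /kd big1 // => a aB; rewrite kext_out ?mulr0 //.
by rewrite cardsU1 aB.
Qed.

Lemma free_map_val m f (b : kgens m) :
  free_map (@kdiff m) (fun a : kgens m.+1 => f (val a)) b = kd f (val b).
Proof.
rewrite -kd_ext; apply: eq_bigr => a ab; congr (_ * _).
have h : #|a |: val b| == m.+1 by rewrite cardsU1 ab (eqP (valP b)).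
by rewrite -[X in kext _ X]/(val (Sub (a |: val b) h : kgens m.+1)) kext_val.
Qed.

Lemma kdiff_graded m (a : kgens m.+1) (b : kgens m) :
  in_twist m m.+1 (kdiff a b).
Proof.
rewrite /in_twist leqnSn subSnn; apply: rpred_sum => i _.
rewrite /ksign -signr_odd; case: (odd _); rewrite ?expr0 ?expr1 ?mulN1r ?mul1r.
  by rewrite rpredN dhomogX; apply/eqP; exact: mdeg1.
by rewrite dhomogX; apply/eqP; exact: mdeg1.
Qed.

Lemma kdiff_diff m (v : kgens m.+2 -> S) c :
  free_map (@kdiff m) (free_map (@kdiff m.+1) v) c = 0.
Proof.
rewrite -(kd_kd (kext v) (val c)) -free_map_val.
by apply: eq_bigr => a _; rewrite kd_ext.
Qed.

Lemma kdiff_exact m (v : kgens m.+1 -> S) :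
  (forall b, free_map (@kdiff m) v b = 0) ->
  exists u : kgens m.+2 -> S, v =1 free_map (@kdiff m.+1) u.
Proof.
move=> v0; have [||u uE] := @kd_exact (kext v).
- move=> B; case: (boolP (#|B| == m)) => Bm; last exact: kd_ext_out.
  by rewrite -[B]/(val (Sub B Bm : kgens m)) kd_ext.
- by rewrite kext_out ?mcoeff0 // cards0.
exists (fun a : kgens m.+2 => u (val a)) => a.
by rewrite free_map_val -uE kext_val.
Qed.

Lemma kaug_diff (v : kgens 1 -> S) :
  \sum_b (free_map (@kdiff 0) v b)@_0%MM * 1 = 0.
Proof.
rewrite big1 // => b _; rewrite mulr1 -kd_ext raddf_sum big1 //= => a _.
by rewrite mulrAC mulrC coefX mnm0E.
Qed.

Lemma kgens0 (a : kgens 0) : val a = set0.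
Proof. by apply/eqP; rewrite -cards_eq0 (valP a). Qed.

Definition kgen0 : kgens 0 := Sub set0 (introT eqP (cards0 _)).

Lemma kaug_exact (v : kgens 0 -> S) : \sum_b (v b)@_0%MM * 1 = 0 ->
  exists u : kgens 1 -> S, v =1 free_map (@kdiff 0) u.
Proof.
rewrite (bigD1 kgen0) //= big1 ?addr0 ?mulr1 => [v0|b /eqP[]]; last first.
  by apply: val_inj; rewrite !kgens0.
have [||u uE] := @kd_exact (kext v).
- move=> B; rewrite /kd big1 // => a _; rewrite kext_out ?mulr0 //.
  by rewrite cards_eq0; apply/set0Pn; exists a; rewrite setU11.
- by rewrite -[set0]/(val kgen0) kext_val.
exists (fun a : kgens 1 => u (val a)) => a.
by rewrite free_map_val -uE kext_val.
Qed.

Lemma kaug_graded (b : kgens 0) : (1 : K) != 0 -> 0%N = 0%N.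
Proof. by []. Qed.

Lemma kaug_surjective : exists b : kgens 0, (1 : K) != 0.
Proof. by exists kgen0; exact: oner_neq0. Qed.

Definition koszul : free_resolution n K :=
  @FreeResolution n K kgens (fun m _ => m) kdiff (fun=> 1) kdiff_graded
    kaug_graded kdiff_diff kaug_diff kdiff_exact kaug_exact kaug_surjective.

End Koszul.

(* Tor_m^S(M, K)_j = 0, for a homogeneous ideal M of S = K[x_0, ..., x_(n-1)],
   with Tor computed from the Koszul resolution of K.  Only j : nat is needed,
   since M and the resolution live in nonnegative degrees. *)
Definition Tor_zero (n : nat) (K : fieldType)
    (M : {mpoly K[n]} -> Prop) (m j : nat) : Prop :=
  homology_vanishes (koszul n K) M m j.

(* r = max { j - m : Tor_m^S(M, K)_j <> 0 }. *)
Definition is_regularity (n : nat) (K : fieldType)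
    (M : {mpoly K[n]} -> Prop) (r : int) : Prop :=
  (exists m j : nat, ~ Tor_zero M m j /\ r = j%:Z - m%:Z) /\
  (forall m j : nat, ~ Tor_zero M m j -> j%:Z - m%:Z <= r).

Section EdgeIdeal.
Variables (K : fieldType) (T : finType) (e : rel T).

(* The variable attached to a vertex, vertices being numbered by enum_rank. *)
Definition vertex_var (v : T) : {mpoly K[#|T|]} := 'X_(enum_rank v).

Definition edge_ideal (p : {mpoly K[#|T|]}) : Prop :=
  exists c : T -> T -> {mpoly K[#|T|]},
    p = \sum_(x : T) \sum_(y : T | e x y) c x y * (vertex_var x * vertex_var y).

Definition k_steps_linear (k : nat) : Prop :=
  forall i j : nat, (1 <= i <= k)%N -> j <> (i + 2)%N ->
    Tor_zero edge_ideal i j.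

Definition max_degree : nat := \max_(x : T) #|[set y | e x y]|.

End EdgeIdeal.

(* Main.v *)
(* Call an induced cycle of length >= 4 of the complement of G a hole. A hole C
   gives a nonzero class in Tor_(|C|-3)(I(G), K)_|C|, so k-step linearity forces
   |C| >= k + 4. In squarefree multidegree W, Tor is computed by the Koszul
   chains e_A such that W \ A contains an edge, and deletion of a vertex x gives
   reg G <= max (reg (G - x), reg (G - N[x]) + 1); with Dirac's theorem on
   simplicial vertices, regularity >= 3 produces a hole.
   By induction on r, an induced subgraph of regularity >= r + 3 contains a hole
   of mean degree at least (k + 1) ((k + 4) / 2)^r: for y nonadjacent to all of a
   hole C, a neighbour of y has at most 2 non-neighbours in C, since otherwise
   there would be a hole of length 4. The maximum degree of G is at least that
   mean degree. *)
Require Import Defs.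
From mathcomp Require Import all_boot all_order all_algebra.
From mathcomp Require Import boolp ring zify lra.
From mathcomp Require mpoly.

Set Implicit Arguments.
Unset Strict Implicit.
Unset Printing Implicit Defensive.

Import Order.TTheory GRing.Theory Num.Theory.
Local Open Scope ring_scope.

(** * Squarefree multidegrees of the Koszul complex as simplicial cochains *)

Section ScalarKoszul.
Import mpoly.
Variables (n : nat) (K : fieldType).
Implicit Types (s : nat) (i a x : 'I_n) (A B F W : {set 'I_n}) (f g : {set 'I_n} -> K).

Definition sgn a B : K := (-1) ^+ #|[set b in B | (b < a)%N]|.

(** The Koszul differential with every variable set to 1; in terms of the complements [W :\: A] it
    is the simplicial coboundary. *)
Definition bdry f B : K := \sum_(a | a \notin B) sgn a B * f (a |: B).

Definition cone i f A : K := if i \in A then sgn i A * f (A :\ i) else 0.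

Lemma sgnK a B : sgn a B * sgn a B = 1.
Proof. by rewrite -expr2 sqrr_sign. Qed.

Lemma sgnU1 a i B : i \notin B -> sgn a (i |: B) = (-1) ^+ (i < a)%N * sgn a B.
Proof.
move=> iB; rewrite /sgn -exprD; congr (_ ^+ _).
case: (boolP (i < a)%N) => ia.
  have -> : [set b in i |: B | (b < a)%N] = i |: [set b in B | (b < a)%N].
    by apply/setP=> b; rewrite !inE; case: eqP => // ->; rewrite ia.
  by rewrite cardsU1 !inE (negbTE iB).
rewrite add0n; apply: eq_card => b; rewrite !inE.
by case: eqP => // ->; rewrite (negbTE ia) !andbF.
Qed.

Lemma sgnD1 i B : sgn i (B :\ i) = sgn i B.
Proof.
case: (boolP (i \in B)) => iB.
  by rewrite -[in RHS](setD1K iB) sgnU1 ?ltnn ?mul1r // !inE eqxx.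
by congr sgn; apply/setP=> b; rewrite !inE; case: eqP => // ->; rewrite (negbTE iB).
Qed.

Lemma eq_bdry f g : f =1 g -> bdry f =1 bdry g.
Proof. by move=> fg B; apply: eq_bigr => a _; rewrite fg. Qed.

Lemma bdryD f g B : bdry (fun A => f A + g A) B = bdry f B + bdry g B.
Proof. by rewrite /bdry -big_split; apply: eq_bigr => a _; rewrite mulrDr. Qed.

Lemma bdryB f g B : bdry (fun A => f A - g A) B = bdry f B - bdry g B.
Proof. by rewrite /bdry -sumrB; apply: eq_bigr => a _; rewrite mulrBr. Qed.

Lemma bdry0 B : bdry (fun=> 0) B = 0.
Proof. by rewrite /bdry big1 // => a _; rewrite mulr0. Qed.

(** Exterior multiplication by e_i is a contracting homotopy. *)
Lemma bdry_cone i f B : bdry (cone i f) B + cone i (bdry f) B = f B.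
Proof.
rewrite /cone /bdry; case: (boolP (i \in B)) => iB; last first.
  rewrite addr0 (bigD1 i) //= big1 ?addr0 => [|a /andP[aB ai]]; last first.
    by rewrite !inE eq_sym (negbTE ai) (negbTE iB) mulr0.
  by rewrite setU11 setU1K // sgnU1 // ltnn expr0 mul1r mulrA sgnK mul1r.
rewrite mulr_sumr [X in _ + X](bigD1 i) /=; last by rewrite !inE eqxx.
rewrite setD1K // sgnD1 mulrA sgnK mul1r addrCA [X in _ + X](_ : _ = 0) ?addr0 //.
rewrite [X in _ + X](eq_bigl (fun a => a \notin B)); last first.
  move=> a; rewrite !inE negb_and negbK; case: eqP => [->|] /=; first by rewrite iB.
  by rewrite andbT.
rewrite -big_split big1 //= => a aB.
have ai : a != i by apply: contraNneq aB => ->.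
have iD : i \notin B :\ i by rewrite !inE eqxx.
have aD : a \notin B :\ i by rewrite !inE (negbTE aB) andbF.
have E : (a |: B) :\ i = a |: (B :\ i).
  by apply/setP=> b; rewrite !inE; case: eqP => // ->; rewrite eq_sym (negbTE ai).
rewrite in_setU1 iB orbT E sgnU1 // -[in X in X * (_ * _)](setD1K iB) sgnU1 //.
case: (ltngtP i a) => [_|_|/val_inj ia]; last by rewrite ia eqxx in ai.
  by rewrite expr0 expr1; ring.
by rewrite expr0 expr1; ring.
Qed.

Lemma bdry_bdry f B : bdry (bdry f) B = 0.
Proof.
(* Evaluating all variables at 1 turns [kd] into [bdry], so the identity descends from [kd_kd]. *)
pose ev := meval (fun _ : 'I_n => 1 : K).
have ev_kd (g : {set 'I_n} -> {mpoly K[n]}) C : ev (kd g C) = bdry (fun A => ev (g A)) C.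
  rewrite /ev /kd rmorph_sum; apply: eq_bigr => a _.
  by rewrite !rmorphM /= mevalXU mulr1 /ksign rmorphXn rmorphN1.
have := congr1 ev (kd_kd (fun A => mpolyC n (f A)) B).
rewrite ev_kd (@eq_bdry _ (bdry f)) => [->|A]; first exact: meval0.
by rewrite ev_kd; apply: eq_bdry => C; apply: mevalC.
Qed.

Definition supported (Q : pred {set 'I_n}) f := forall A, f A != 0 -> Q A.

(* Sets are indexed by the Koszul generators e_A; the condition P bears on the
   support W \ A of the monomial coefficient, so that s is the difference
   (internal degree) - (homological degree). *)
Definition slot W (P : pred {set 'I_n}) (s : nat) : pred {set 'I_n} :=
  fun A => [&& A \subset W, P (W :\: A) & #|W :\: A| == s].

(** When [P] is the presence of an edge and [W] is nonempty, this is the vanishing of the cohomology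
    of the full simplex relative to the independence complex of [W], hence of the reduced cohomology
    of that complex in degree [s - 1]. *)
Definition exact_at W (P : pred {set 'I_n}) (s : nat) : Prop :=
  forall f, supported (slot W P s.+1) f -> bdry f =1 (fun=> 0) ->
  exists2 g, supported (slot W P s) g & f =1 bdry g.

Lemma eq_exact_at W (P P' : pred {set 'I_n}) s :
  (forall F, F \subset W -> P F = P' F) -> exact_at W P s -> exact_at W P' s.
Proof.
move=> PP' ex f fs f0; have slotE t A : slot W P t A = slot W P' t A.
  by rewrite /slot PP' // subsetDl.
have [||g gs fE] := ex f; [by move=> A /fs; rewrite slotE|by []|].
by exists g => // A /gs; rewrite slotE.
Qed.

Lemma setD_setD1 W A x : x \in A -> (W :\ x) :\: (A :\ x) = W :\: A.
Proof.
move=> xA; apply/setP=> b; rewrite !inE.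
by case: eqP => //= ->; rewrite xA.
Qed.

Lemma setD1_setDU W A x : x \in W -> x \notin A -> x |: (W :\ x :\: A) = W :\: A.
Proof.
move=> xW xA; apply/setP=> b; rewrite !inE.
by case: eqP => //= ->; rewrite xA xW.
Qed.

(* Exactness at the middle of a long exact sequence: a cycle is first moved off
   the sets containing x, and what is left is a cycle for the link of x. *)
Lemma exact_at_del W (P : pred {set 'I_n}) s x : x \in W ->
  (forall F, P F -> P (x |: F)) -> exact_at (W :\ x) P s.+1 ->
  exact_at (W :\ x) (fun F => P (x |: F)) s -> exact_at W P s.+1.
Proof.
move=> xW Pmono exdel exlk f fs f0.
(* [f] splits as [fx] plus e_x times [h], both supported on sets avoiding [x]. *)
pose h B := if x \in B then 0 else sgn x B * f (x |: B).
pose fx A := if x \in A then 0 else f A.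
have fE A : f A = fx A + cone x h A.
  rewrite /fx /cone; case: (boolP (x \in A)) => xA; last by rewrite addr0.
  by rewrite add0r /h !inE eqxx /= sgnD1 setD1K // mulrA sgnK mul1r.
have fx0 B : x \in B -> bdry fx B = 0.
  by move=> xB; rewrite /bdry big1 // => a _; rewrite /fx !inE xB orbT mulr0.
have h0 : bdry h =1 (fun=> 0).
  move=> B; case: (boolP (x \in B)) => xB.
    by rewrite /bdry big1 // => a _; rewrite /h !inE xB orbT mulr0.
  have := bdry_cone x h (x |: B).
  have -> : bdry (cone x h) (x |: B) = 0.
    have := f0 (x |: B); rewrite (eq_bdry fE) bdryD fx0 ?setU11 //.
    by rewrite add0r.
  rewrite add0r /cone /h setU11 setU1K // => /eqP.
  by rewrite mulf_eq0 signr_eq0 => /eqP.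
have hs : supported (slot (W :\ x) P s.+2) h.
  move=> A; rewrite /h; case: (boolP (x \in A)) => xA; first by rewrite eqxx.
  rewrite mulf_eq0 signr_eq0 /= => /fs /and3P[sA pA cA].
  have sA' : A \subset W :\ x.
    by rewrite subsetD1 xA (subset_trans (subsetUr _ _) sA).
  by apply/and3P; rewrite -(setU1K xA) setD_setD1 ?setU11 // setU1K.
have [g1 g1s hE] := exdel h hs h0.
(* [f2] is [f] plus a boundary and lives on sets avoiding [x], whose complements in [W] contain
   [x]. *)
pose f2 A := fx A + g1 A.
have f2E A : f2 A = f A + bdry (cone x g1) A.
  rewrite /f2 fE -addrA; congr (_ + _).
  rewrite -{1}(bdry_cone x g1 A) addrC; congr (_ + _).
  by rewrite /cone; case: ifP => // _; rewrite hE.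
have f20 : bdry f2 =1 (fun=> 0).
  by move=> B; rewrite (eq_bdry f2E) bdryD f0 bdry_bdry addr0.
have f2s : supported (slot (W :\ x) (fun F => P (x |: F)) s.+1) f2.
  move=> A; case: (eqVneq (g1 A) 0) => [g10|/g1s/and3P[sA pA cA]]; last first.
    by rewrite /slot sA cA Pmono.
  rewrite /f2 g10 addr0 /fx; case: (boolP (x \in A)) => xA; first by rewrite eqxx.
  move/fs=> /and3P[sA pA]; rewrite /slot subsetD1 sA xA setD1_setDU // pA.
  by rewrite -(setD1_setDU xW xA) cardsU1 !inE eqxx /= andbF.
have [g2 g2s f2b] := exlk f2 f2s f20.
exists (fun A => g2 A - cone x g1 A); last first.
  by move=> A; rewrite bdryB -f2b f2E addrK.
move=> A; case: (eqVneq (g2 A) 0) => [->|/g2s/and3P[]].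
  rewrite sub0r oppr_eq0 /cone; case: (boolP (x \in A)) => xA; last by rewrite eqxx.
  rewrite mulf_eq0 signr_eq0 /= => /g1s; rewrite /slot setD_setD1 // => /andP[sA ->].
  by rewrite andbT -(setD1K xA) subUset sub1set xW (subset_trans sA) ?subsetDl.
rewrite subsetD1 => /andP[sA xA] pA cA _; rewrite /slot sA -(setD1_setDU xW xA) pA.
by rewrite cardsU1 (eqP cA) !inE eqxx andbF add1n eqxx.
Qed.

(** The full simplex on a nonempty [W] is a cone over any vertex; for empty [W] the slot [s.+1] is
    empty. *)
Lemma exact_at_full W (P : pred {set 'I_n}) s :
  (forall F, F \subset W -> P F) -> exact_at W P s.
Proof.
move=> PT; apply: (@eq_exact_at W predT) => [F /PT ->|f fs f0] //.
have [W0|[i iW]] := set_0Vmem W.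
  exists (fun=> 0) => [A|A]; first by rewrite eqxx.
  rewrite bdry0; apply: contraTeq isT => /fs/and3P[_ _].
  by rewrite W0 set0D cards0.
exists (cone i f) => [A|A]; last first.
  by rewrite -[LHS](bdry_cone i f) /cone f0 mulr0 if_same addr0.
rewrite /cone; case: (boolP (i \in A)) => iA; last by rewrite eqxx.
rewrite mulf_eq0 signr_eq0 /= => /fs/and3P[sA _ cA]; apply/and3P; split=> //.
  by rewrite -(setD1K iA) subUset sub1set iW.
have iWA : i \notin W :\: A by rewrite !inE iA.
rewrite -eqSS -(eqP cA); apply/eqP; rewrite -add1n -[1%N]/(true : nat) -iWA -cardsU1.
congr #|pred_of_set _|; apply/setP=> b; rewrite !inE.
by case: eqP => //= ->; rewrite iW.
Qed.

Lemma exact_at_void W (P : pred {set 'I_n}) s :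
  (forall F, F \subset W -> P F = false) -> exact_at W P s.
Proof.
move=> PF f fs _; exists (fun=> 0) => [A|A]; first by rewrite eqxx.
rewrite bdry0; apply: contraTeq isT => /fs/and3P[_].
by rewrite PF ?subsetDl.
Qed.

End ScalarKoszul.

(** * Induced cycles of the complement *)

Section Holes.
Variables (T : finType) (e : rel T).

Definition nonadj x y := (x != y) && ~~ e x y.

Definition has_edge (F : {set T}) : bool := [exists x in F, exists y in F, e x y].

(* An induced cycle of length at least 4 in the complement of e, described by
   the only features of it that are used: degrees at most 2, no triangle, and an
   edge ab whose ends remain connected when it is removed. *)
Definition hole (C : {set T}) : Prop :=
  [/\ (4 <= #|C|)%N,
      {in C & C & C, forall x y z, nonadj x y -> nonadj y z -> ~~ nonadj x z},
      {in C, forall x, (#|[set y in C | nonadj x y]| <= 2)%N} &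
      exists a b, [/\ a \in C, b \in C, nonadj a b &
        connect (fun c d => [&& c \in C, d \in C, nonadj c d &
                             [set c; d] != [set a; b]]) a b]].

Lemma has_edgeP (F : {set T}) :
  reflect (exists x y, [/\ x \in F, y \in F & e x y]) (has_edge F).
Proof.
apply: (iffP exists_inP) => [[x xF /exists_inP[y yF exy]]|[x [y [xF yF exy]]]].
  by exists x, y.
by exists x => //; apply/exists_inP; exists y.
Qed.

Lemma has_edgeS (F F' : {set T}) : F \subset F' -> has_edge F -> has_edge F'.
Proof.
move=> /subsetP sF /has_edgeP[x [y [xF yF exy]]].
by apply/has_edgeP; exists x, y; rewrite !sF.
Qed.

Lemma nonadj_sym : symmetric e -> symmetric nonadj.
Proof. by move=> e_sym x y; rewrite /nonadj eq_sym e_sym. Qed.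

End Holes.

(** * Deletion inequality for regularity, and nonvanishing at a hole *)

Section GraphComplex.
Variables (n : nat) (K : fieldType) (e : rel 'I_n).
Hypotheses (e_sym : symmetric e) (e_irr : irreflexive e).
Implicit Types (s t : nat) (a b c d x : 'I_n) (A B F W C : {set 'I_n}).

Local Notation exact_at := (@exact_at n K).

(* exact_at W (has_edge e) s is the vanishing of the multidegree W part of
   Tor_m(I(G), K) with #|W| - m = s + 1, so this says that these parts all
   have j - m <= t. *)
Definition reg_le W t : Prop := forall s, (t <= s)%N -> exact_at W (has_edge e) s.

(** A neighbour [y] of [x] can be deleted from [W]: every set with [x] and [y] adjoined contains an
    edge, so the link of [y] is full. The bound [0 < s] comes from [exact_at_del], which concludes
    in degree [s.+1]. *)
Lemma exact_at_link W x s : (0 < s)%N ->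
  exact_at [set y in W | ~~ e x y] (fun F => has_edge e (x |: F)) s ->
  exact_at W (fun F => has_edge e (x |: F)) s.
Proof.
case: s => // s _; have [m] := ubnP #|W|; elim: m W => // m IH W Wm ex.
case: (pickP [pred y in W | e x y]) => [y /andP[yW exy]|none]; last first.
  suff <- : [set y in W | ~~ e x y] = W by [].
  by apply/setP=> y; rewrite !inE; have /= := none y; case: (y \in W) => //= ->.
apply: (@exact_at_del _ _ _ _ _ y) => // [F||].
- by apply: has_edgeS; rewrite setUCA subsetUr.
- apply: IH; first by rewrite (cardsD1 y) yW in Wm.
  suff -> : [set z in W :\ y | ~~ e x z] = [set z in W | ~~ e x z] by [].
  by apply/setP=> z; rewrite !inE; case: eqP => //= ->; rewrite exy andbF.
- apply: exact_at_full => F _; apply/has_edgeP; exists x, y.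
  by rewrite !inE !eqxx orbT.
Qed.

(** Once the neighbours of [x] are discarded from its link, adjoining [x] creates no new edge. With
    [2 <= t] the link is used in positive degrees only, as [exact_at_link] demands. *)
Lemma reg_le_step W t x : (2 <= t)%N -> x \in W -> reg_le (W :\ x) t ->
  reg_le [set y in W :\ x | ~~ e x y] t.-1 -> reg_le W t.
Proof.
case: t => [//|[//|t]] _ xW del lk [//|s] ts.
apply: (exact_at_del xW) => [F||]; first exact: has_edgeS (subsetUr _ _).
  exact: del.
apply: exact_at_link; first by case: s ts.
apply: eq_exact_at (lk s ts) => F /subsetP sF.
apply/idP/idP => [|/has_edgeP[u [v [/setU1P uF /setU1P vF]]]].
  exact: has_edgeS (subsetUr _ _).
have Nx w : w \in F -> ~~ e x w by move=> /sF; rewrite inE => /andP[].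
case: uF vF => [->|uF] [->|vF] euv.
- by rewrite e_irr in euv.
- by rewrite (negbTE (Nx _ vF)) in euv.
- by rewrite e_sym (negbTE (Nx _ uF)) in euv.
- by apply/has_edgeP; exists u, v.
Qed.

Lemma reg_le_edgeless W t : ~~ has_edge e W -> reg_le W t.
Proof.
move=> W0 s _; apply: exact_at_void => F FW.
by apply: contraNF W0; apply: has_edgeS.
Qed.

Lemma reg_leW W t t' : (t <= t')%N -> reg_le W t -> reg_le W t'.
Proof. by move=> tt' r s /(leq_trans tt') /r. Qed.

(** Twisted by [sgn K c C], [psi] becomes a function on the vertices of [C] whose coboundary on a
    pair is, up to sign, the difference of its two values. *)
Lemma bdry_pair_eq0 C (psi : {set 'I_n} -> K) c d :
  (forall A, ~~ (A \subset C) -> psi A = 0) -> c \in C -> d \in C -> c != d ->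
  (bdry psi (C :\: [set c; d]) == 0) =
  (sgn K c C * psi (C :\ c) == sgn K d C * psi (C :\ d)).
Proof.
move=> supp cC dC cd; set B := C :\: _.
have cB : c \notin B by rewrite !inE eqxx.
have dB : d \notin B by rewrite !inE eqxx orbT.
have Cd : C :\ d = c |: B.
  by apply/setP=> z; rewrite !inE; case: (eqVneq z c) => [->|]; rewrite ?cd ?cC.
have Cc : C :\ c = d |: B.
  apply/setP=> z; rewrite !inE; case: (eqVneq z d) => [->|zd]; last by rewrite orbF.
  by rewrite eq_sym cd dC.
have -> : bdry psi B = sgn K c B * psi (C :\ d) + sgn K d B * psi (C :\ c).
  rewrite /bdry (bigD1 c) //= (bigD1 d) /=; last by rewrite dB eq_sym cd.
  rewrite -Cd -Cc big1 ?addr0 // => z /andP[/andP[zB zc] zd].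
  rewrite supp ?mulr0 //; apply/negP=> /subsetP/(_ z); rewrite setU11.
  by move/(_ isT) => zC; move: zB; rewrite !inE zC (negbTE zc) (negbTE zd).
have -> : sgn K c C = (-1) ^+ (d < c)%N * sgn K c B.
  by rewrite -(sgnD1 _ c C) Cc sgnU1.
have -> : sgn K d C = (-1) ^+ (c < d)%N * sgn K d B.
  by rewrite -(sgnD1 _ d C) Cd sgnU1.
move: (psi (C :\ c)) (psi (C :\ d)) => p q; rewrite -[RHS]subr_eq0.
have -> : (sgn K c B * q + sgn K d B * p == 0) = (sgn K c B * p + sgn K d B * q == 0).
  have nz : sgn K c B * sgn K d B != 0 by rewrite mulf_neq0 ?signr_eq0.
  rewrite -(inj_eq (mulfI nz)) mulr0; congr (_ == _).
  transitivity ((sgn K c B * sgn K c B) * (sgn K d B * q) +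
                (sgn K d B * sgn K d B) * (sgn K c B * p)); first by ring.
  by rewrite !sgnK !mul1r addrC.
case: (ltngtP c d) => [_|_|/val_inj E]; last by rewrite E eqxx in cd.
  by rewrite expr0 expr1 mul1r mulN1r mulNr opprK.
by rewrite expr0 expr1 mul1r mulN1r mulNr -opprD oppr_eq0.
Qed.

(* In the full simplex on C the chain phi - g would be the coboundary of a
   function on vertices, constant along every complement edge but ab. *)
Lemma hole_not_exact C : hole e C -> ~ exact_at C (has_edge e) 2.
Proof.
case=> _ tri _ [a [b [aC bC ab conn]]] ex.
have /andP[a_neq_b eab] := ab.
have pairC c d : c \in C -> d \in C -> C :\: (C :\: [set c; d]) = [set c; d].
  move=> cC dC; rewrite setDDr setDv set0U; apply/setIidPr.
  by apply/subsetP=> z /set2P[] ->.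
(* [phi] is the indicator of the pair [ab], which is not an edge of [e], so [phi] is not itself an
   admissible primitive of [bdry phi]. *)
pose phi A : K := (A == C :\: [set a; b])%:R.
have phi_eq0 A : (phi A == 0) = (A != C :\: [set a; b]).
  by rewrite /phi; case: (A == _); rewrite ?oner_eq0 ?eqxx.
have phi_n0 A : phi A != 0 -> A = C :\: [set a; b] by rewrite phi_eq0 negbK => /eqP.
(* [bdry phi] lives on triples [abc], and each contains an edge of [e] because the complement has no
   triangle in [C]. *)
have [||g gs phiE] := ex (bdry phi).
- move=> A nz; have [c cA pc] : exists2 c, c \notin A & phi (c |: A) != 0.
    apply/exists_inP; apply: contraNT nz => /exists_inPn h.
    rewrite /bdry big1 // => c cA; apply/eqP; rewrite mulf_eq0 orbC.
    by have /negbNE -> := h c cA.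
  have E := phi_n0 _ pc; have cC : c \in C :\: [set a; b] by rewrite -E setU11.
  have AC : A \subset C.
    by apply: subset_trans (subsetUr [set c] _) _; rewrite E subsetDl.
  have CA : C :\: A = c |: [set a; b].
    rewrite -(pairC _ _ aC bC) -E; apply/setP=> z; rewrite !inE.
    by case: (eqVneq z c) cC => [->|//]; rewrite inE => /andP[_ ->]; rewrite cA.
  move: cC; rewrite !inE negb_or => /andP[/andP[ca cb] cC].
  rewrite /slot AC CA cardsU1 cards2 a_neq_b !inE negb_or ca cb /=.
  rewrite andbT; apply/has_edgeP; case: (boolP (e a c)) => [eac|nac].
    by exists a, c; rewrite !inE !eqxx !orbT.
  have nca : nonadj e c a by rewrite /nonadj ca e_sym.
  have := tri _ _ _ cC aC bC nca ab; rewrite /nonadj cb negbK => ecb.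
  by exists c, b; rewrite !inE !eqxx !orbT.
- exact: bdry_bdry.
have [||psi psis rhoE] := @exact_at_full n K C predT 1 (fun _ _ => isT) (fun A => phi A - g A).
- move=> A; case: (eqVneq (g A) 0) => [->|/gs/and3P[sA _ cA] _]; last exact/and3P.
  rewrite subr0 => /phi_n0 ->; rewrite /slot subsetDl pairC //=.
  by rewrite cards2 a_neq_b.
- by move=> B; rewrite bdryB phiE subrr.
have psi0 A : ~~ (A \subset C) -> psi A = 0.
  by apply: contraNeq => /psis/andP[].
(* [theta] is constant along complement edges other than [ab], hence along the path from [a] to [b],
   yet must differ across [ab]. *)
pose theta c := sgn K c C * psi (C :\ c).
have theta_eq c d : c \in C -> d \in C -> nonadj e c d ->
  (theta c == theta d) = ([set c; d] != [set a; b]).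
  move=> cC dC /andP[cd ecd]; rewrite /theta -bdry_pair_eq0 // -rhoE.
  have -> : g (C :\: [set c; d]) = 0.
    apply: contraTeq isT => /gs/and3P[_]; rewrite pairC // => /has_edgeP[u [v]].
    case=> /set2P[] -> /set2P[] ->; rewrite ?e_irr ?(negbTE ecd) //.
    by rewrite e_sym (negbTE ecd).
  rewrite subr0 phi_eq0; congr (~~ _); apply/eqP/eqP => [E|-> //].
  by rewrite -(pairC _ _ cC dC) E pairC.
have theta_path d p : path (fun c d => [&& c \in C, d \in C, nonadj e c d &
    [set c; d] != [set a; b]]) d p -> theta d == theta (last d p).
  elim: p d => [|c p IH] d //= /andP[/and4P[dC cC dc neq] /IH/eqP <-].
  by rewrite theta_eq.
case/connectP: conn => p /theta_path/[swap] <-.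
by rewrite theta_eq // eqxx.
Qed.

End GraphComplex.

(** * Multidegrees of polynomial Koszul chains *)

Section MultigradedPieces.
Import mpoly.
Variables (n : nat) (K : fieldType).
Implicit Types (i a : 'I_n) (A B W : {set 'I_n}) (al be : 'X_{1..n})
  (V : {set 'I_n} -> {mpoly K[n]}).

Definition mset A : 'X_{1..n} := [multinom (i \in A : nat) | i < n].

Definition mvars al : {set 'I_n} := [set i | (0 < al i)%N].

(* Coefficients of the multidegree al component of the chain A |-> V A. *)
Definition mpiece V al A : K := if A \subset mvars al then (V A)@_(al - mset A) else 0.

Lemma msetE A i : mset A i = (i \in A). Proof. exact: mnmE. Qed.

Lemma mdeg_mset A : mdeg (mset A) = #|A|.
Proof.
rewrite mdegE -sum1_card [RHS]big_mkcond; apply: eq_bigr => i _.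
by rewrite msetE; case: (i \in A).
Qed.

Lemma mvars_mset A : mvars (mset A) = A.
Proof. by apply/setP=> i; rewrite inE msetE; case: (i \in A). Qed.

Lemma msubK al A : A \subset mvars al -> (al - mset A + mset A)%MM = al.
Proof.
move=> /subsetP sA; apply/mnmP=> i; rewrite mnmDE mnmBE msetE subnK //.
by case: (boolP (i \in A)) => // /sA; rewrite inE.
Qed.

Lemma msetD W A : A \subset W -> (mset W - mset A)%MM = mset (W :\: A).
Proof.
move=> sA; apply/mnmP=> i; rewrite mnmBE !msetE inE.
by case: (boolP (i \in A)) => [iA|_]; rewrite ?subn0 // (subsetP sA i iA).
Qed.

(** The differential preserves multidegree: the factor x_a compensates for removing [a] from the
    index set. *)
Lemma bdry_mpiece V al : bdry (mpiece V al) =1 mpiece (kd V) al.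
Proof.
move=> B; rewrite /mpiece; case: (boolP (B \subset mvars al)) => sB; last first.
  rewrite /bdry big1 // => a _; rewrite ifN ?mulr0 //.
  by apply: contra sB; apply: subset_trans (subsetUr _ _).
rewrite /bdry /kd raddf_sum; apply: eq_bigr => a aB /=.
have -> p : (ksign K a B * 'X_a * p)@_(al - mset B) =
            sgn K a B * ('X_a * p)@_(al - mset B).
  rewrite /ksign /sgn -mulrA -signr_odd -[in RHS]signr_odd.
  by case: odd; rewrite ?expr0 ?expr1 ?mul1r ?mulN1r ?mcoeffN.
congr (_ * _); rewrite Defs.coefX mnmBE msetE (negbTE aB) subn0.
rewrite subUset sub1set sB andbT inE; case: ifP => // _.
rewrite submDA; congr (_ @_ (_ - _)); apply/mnmP=> i.
rewrite mnmDE mnm1E !msetE !inE (eq_sym i); case: eqP => [<-|_]; last by rewrite addn0.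
by rewrite (negbTE aB).
Qed.

End MultigradedPieces.

(** * Tor of the edge ideal in terms of [exact_at] *)

Section TorEdgeIdeal.
Import mpoly.
Variables (K : fieldType) (T : finType) (e : rel T).
Hypothesis e_irr : irreflexive e.
Local Notation n := #|T|.
Implicit Types (A B W : {set 'I_n}) (al be : 'X_{1..n}) (m j s : nat).

Definition ord_edge : rel 'I_n := [rel i j | e (enum_val i) (enum_val j)].

Local Notation I := (@edge_ideal K T e).

(** A monomial ideal is tested monomial by monomial. Irreflexivity makes the ends of an edge
    distinct variables, so if both occur in a monomial, their product divides it. *)
Lemma edge_idealP p : I p <-> forall be, p@_be != 0 -> has_edge ord_edge (mvars be).
Proof.
split=> [[c ->] be|h].
  rewrite raddf_sum /= => nz.
  have [x _ {}nz] : exists2 x, true & (\sum_(y | e x y)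
      c x y * (vertex_var K x * vertex_var K y))@_be != 0.
    apply/exists_inP; apply: contraNT nz => /exists_inPn h.
    by rewrite big1 // => x _; apply/eqP; rewrite -[_ == _]negbK h.
  move: nz; rewrite raddf_sum /= => nz.
  have [y exy {}nz] : exists2 y, e x y &
      (c x y * (vertex_var K x * vertex_var K y))@_be != 0.
    apply/exists_inP; apply: contraNT nz => /exists_inPn h.
    by rewrite big1 // => y /h; rewrite negbK => /eqP.
  move: nz; rewrite mulrCA (mulrC (c x y)) !Defs.coefX.
  case: ifP => [bx|]; last by rewrite eqxx.
  case: ifP => [|]; last by rewrite eqxx.
  rewrite mnmBE => by0 _; apply/has_edgeP; exists (enum_rank x), (enum_rank y).
  by rewrite !inE bx /ord_edge /= !enum_rankK exy (leq_trans by0) ?leq_subr.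
rewrite (mpolyE p) big_seq; elim/big_ind: _.
- exists (fun _ _ => 0); rewrite big1 // => x _.
  by rewrite big1 // => y _; rewrite mul0r.
- move=> _ _ [c ->] [d ->]; exists (fun x y => c x y + d x y).
  rewrite -big_split; apply: eq_bigr => x _; rewrite -big_split.
  by apply: eq_bigr => y _; rewrite mulrDl.
move=> be; rewrite mcoeff_msupp => /h/has_edgeP[i [k [ib kb eik]]].
have ik : i != k by apply: contraTneq eik => ->; rewrite /ord_edge /= e_irr.
move: ib kb; rewrite !inE => ib kb.
exists (fun x y => if (x == enum_val i) && (y == enum_val k)
                   then p@_be *: 'X_[be - U_(i) - U_(k)] else 0).
rewrite (bigD1 (enum_val i)) //= (bigD1 (enum_val k)) //= !eqxx /= big1; last first.
  by move=> y /andP[_ /negbTE ->]; rewrite mul0r.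
rewrite big1 => [|x /negbTE ->]; last by rewrite big1 // => y _; rewrite mul0r.
rewrite !addr0 /vertex_var !enum_valK -scalerAl -!mpolyXD; congr (_ *: 'X_[_]).
apply/mnmP=> l; rewrite !(mnmDE, mnmBE, mnm1E).
case: (i =P l) => [<-|_]; last first.
  case: (k =P l) => [<-|_]; last by rewrite !subn0 !addn0.
  by rewrite subn0 add0n subnK.
by rewrite eq_sym (negbTE ik) !subn0 addn0 subnK.
Qed.

Local Notation koszul := (koszul n K).

Lemma kext_cycle m (v : gens koszul m -> {mpoly K[n]}) :
  tensor_cycle v -> kd (kext v) =1 fun=> 0.
Proof.
case: m v => [|m] v cyc B.
  rewrite /kd big1 // => a _; rewrite kext_out ?mulr0 // cards_eq0.
  by apply/set0Pn; exists a; rewrite setU11.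
case: (boolP (#|B| == m)) => Bm; last exact: kd_ext_out.
by rewrite -[B]/(val (Sub B Bm : kgens n m)) kd_ext; apply: cyc.
Qed.

Lemma in_twist_coef d j (p : {mpoly K[n]}) :
  in_twist d j p <-> forall be, p@_be != 0 -> (mdeg be + d = j)%N.
Proof.
rewrite /in_twist; case: leqP => dj; split.
- move=> /dhomogP ph be; rewrite -mcoeff_msupp => /ph ->.
  by rewrite subnK.
- move=> h; apply/dhomogP => be; rewrite mcoeff_msupp => /h <-.
  by rewrite addnK.
- by move/eqP=> -> be; rewrite mcoeff0 eqxx.
move=> h; apply/eqP/mpolyP => be; rewrite mcoeff0; apply/eqP.
by apply: contraTT dj => /h <-; rewrite -leqNgt leq_addl.
Qed.

(* If al is not squarefree, a variable of exponent at least 2 is a cone point. *)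
Lemma multigraded_exact m j al (f : {set 'I_n} -> K) :
  (forall W, #|W| = j -> exact_at K W (has_edge ord_edge) (j - m.+1)) ->
  (m < j)%N -> mdeg al = j ->
  (forall A, f A != 0 -> [/\ A \subset mvars al, #|A| = m &
                             has_edge ord_edge (mvars (al - mset A))]) ->
  bdry f =1 (fun=> 0) ->
  exists2 g, f =1 bdry g &
    forall A, g A != 0 -> [/\ A \subset mvars al, #|A| = m.+1 &
                             has_edge ord_edge (mvars (al - mset A))].
Proof.
move=> ex mj alj fs f0.
case: (pickP (fun i => 1 < al i)%N) => [i ali|sqf].
  exists (cone i f) => A.
    by rewrite -[LHS](bdry_cone i f) /cone f0 mulr0 if_same addr0.
  rewrite /cone; case: (boolP (i \in A)) => iA; last by rewrite eqxx.
  rewrite mulf_eq0 signr_eq0 /= => /fs[sA cA edge]; split.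
  - by rewrite -(setD1K iA) subUset sub1set sA inE (ltnW ali).
  - by rewrite (cardsD1 i) iA cA.
  suff <- : mvars (al - mset (A :\ i)) = mvars (al - mset A) by [].
  apply/setP=> k; rewrite !inE !mnmBE !msetE !inE.
  by case: eqP => //= ->; rewrite iA subn0 subn_gt0 ali ltnW.
have alE : al = mset (mvars al).
  apply/mnmP=> i; rewrite msetE inE; have := sqf i => /=.
  by case: (al i) => [|[]].
have cW : #|mvars al| = j by rewrite -alj {2}alE mdeg_mset.
have subD A : A \subset mvars al -> mvars (al - mset A) = mvars al :\: A.
  by move=> sA; rewrite {1}alE msetD // mvars_mset.
have [||g gs fE] := ex _ cW f; [|exact: f0|].
  move=> A /fs[sA cA]; rewrite subD // => edge; apply/and3P; split=> //.
  by rewrite cardsD (setIidPr sA) cW cA subnS prednK // subn_gt0.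
exists g => // A /gs/and3P[sA edge cA]; rewrite subD //; split=> //.
have := subset_leq_card sA; rewrite cW => Aj.
move: cA; rewrite cardsD (setIidPr sA) cW => /eqP cA.
by rewrite -(subKn Aj) cA subKn.
Qed.

(** A primitive is chosen in each multidegree of total degree [j], and these are summed to a
    polynomial chain. *)
Lemma Tor_zero_exact m j :
  (forall W, #|W| = j -> exact_at K W (has_edge ord_edge) (j - m.+1)) ->
  Tor_zero I m j.
Proof.
move=> ex v vch vcyc; rewrite /tensor_boundary.
have kv0 := kext_cycle vcyc.
have v_deg a be : (v a)@_be != 0 -> (mdeg be + m = j)%N.
  by have [_] := vch a => /in_twist_coef; apply.
have v_edge a be : (v a)@_be != 0 -> has_edge ord_edge (mvars be).
  by have [/edge_idealP h _] := vch a; apply: h.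
(* For [j <= m] the chains vanish, since elements of the edge ideal have no constant term. *)
case: (leqP j m) => [jm|mj].
  have v0 a : v a = 0.
    apply/mpolyP=> be; rewrite mcoeff0; apply/eqP; apply: contraTT isT => nz.
    have := v_deg _ _ nz; have /has_edgeP[i [_ [ib _ _]]] := v_edge _ _ nz.
    move: ib; rewrite inE => ib; have: (0 < mdeg be)%N.
      by rewrite mdegE (bigD1 i) //= (leq_trans ib) ?leq_addr.
    by move=> be0 bej; move: jm; rewrite -bej leqNgt -{1}[m]add0n ltn_add2r be0.
  exists (fun=> 0); split=> [a|a].
    split; last by apply/in_twist_coef => be; rewrite mcoeff0 eqxx.
    by apply/edge_idealP => be; rewrite mcoeff0 eqxx.
  by rewrite v0 /free_map big1 // => b _; rewrite mul0r.
pose good al (g : {set 'I_n} -> K) := mdeg al = j -> mpiece (kext v) al =1 bdry g /\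
    forall A, g A != 0 -> [/\ A \subset mvars al, #|A| = m.+1 &
                             has_edge ord_edge (mvars (al - mset A))].
have /choice[g gP] : forall al, exists g, good al g.
  move=> al; rewrite /good.
  case: (eqVneq (mdeg al) j) => [alj|/eqP alj]; last by exists (fun=> 0).
  have [|B|g fE gs] := multigraded_exact (f := mpiece (kext v) al) ex mj alj.
  - move=> A; rewrite /mpiece; case: ifP => sA; last by rewrite eqxx.
    case: (boolP (#|A| == m)) => Am; last by rewrite kext_out // mcoeff0 eqxx.
    rewrite -[A]/(val (Sub A Am : kgens n m)) kext_val /= => /v_edge edge.
    by split=> //; exact/eqP.
  - by rewrite bdry_mpiece /mpiece kv0 mcoeff0 if_same.
  by exists g.
pose G al A := if mdeg al == j then g al A else 0.
have G_n0 al A : G al A != 0 -> [/\ A \subset mvars al, #|A| = m.+1,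
    has_edge ord_edge (mvars (al - mset A)) & mdeg al = j].
  rewrite /G; case: ifP => [/eqP alj|]; last by rewrite eqxx.
  by have [_ h] := gP _ alj; case/h=> sA cA edge.
(* Only exponents of degree at most [j] can contribute, so a finite index type suffices. *)
pose u (a : kgens n m.+1) : {mpoly K[n]} :=
  \sum_(be : 'X_{1..n < j.+1}) G (be + mset (val a))%MM (val a) *: 'X_[be].
have uE a be : (u a)@_be = G (be + mset (val a))%MM (val a).
  rewrite /u raddf_sum /=; case: (ltnP (mdeg be) j.+1) => bej.
    rewrite (bigD1 (BMultinom bej)) //= mcoeffZ mcoeffX eqxx mulr1.
    rewrite big1 ?addr0 // => be' /negbTE nbe.
    by rewrite mcoeffZ mcoeffX -[_ == be]/(be' == BMultinom bej) nbe mulr0.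
  rewrite big1 => [|be' _].
    apply/esym/eqP; apply: contraTT bej => /G_n0[_ _ _].
    by rewrite mdegD -leqNgt => <-; rewrite leq_addr.
  rewrite mcoeffZ mcoeffX; case: eqP => [E|_]; last by rewrite mulr0.
  by move: bej; rewrite -E leqNgt bmdeg.
have GE al A : mpiece (kext u) al A = G al A.
  rewrite /mpiece; case: (boolP (A \subset mvars al)) => sA; last first.
    by apply/esym/eqP; apply: contraNT sA => /G_n0[].
  case: (boolP (#|A| == m.+1)) => Am; last first.
    rewrite kext_out // mcoeff0; apply/esym/eqP.
    by apply: contraNT Am => /G_n0[_ ->].
  by rewrite -[A]/(val (Sub A Am : kgens n m.+1)) kext_val uE /= msubK.
exists u; split=> [a|a].
  split.
    apply/edge_idealP => be; rewrite uE => /G_n0[_ _ edge _].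
    by rewrite addmK in edge.
  apply/in_twist_coef => be; rewrite uE => /G_n0[_ cA _ <-].
  by rewrite mdegD mdeg_mset cA.
rewrite -[RHS]kd_ext; apply/mpolyP=> be.
have sa : val a \subset mvars (be + mset (val a)).
  by apply/subsetP=> i ia; rewrite inE mnmDE msetE ia addn1.
have pieceE (V : {set 'I_n} -> {mpoly K[n]}) : (V (val a))@_be = mpiece V (be + mset (val a))%MM (val a).
  by rewrite /mpiece sa addmK.
rewrite (pieceE (kd (kext u))) -bdry_mpiece (eq_bdry (GE _)).
case: (eqVneq (mdeg (be + mset (val a))) j) => alj.
  rewrite -kext_val (pieceE (kext v)); have [-> _] := gP _ alj.
  by apply: eq_bdry => A; rewrite /G alj eqxx.
rewrite (@eq_bdry _ _ _ (fun=> 0)) => [|A]; last by rewrite /G (negbTE alj).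
rewrite bdry0; apply/eqP; apply: contraNT alj => /v_deg <-.
by rewrite mdegD mdeg_mset (eqP (valP a)).
Qed.

(** A scalar cycle is homogenised by attaching to [A] the monomial of [W :\: A]; the component of
    multidegree [mset W] of a primitive then gives a scalar primitive. *)
Lemma exact_Tor_zero m s W : #|W| = (m + s.+1)%N -> Tor_zero I m #|W| ->
  exact_at K W (has_edge ord_edge) s.
Proof.
move=> cW tor f fs f0.
have f_n0 A : f A != 0 -> [/\ A \subset W, #|A| = m & has_edge ord_edge (W :\: A)].
  move=> /fs/and3P[sA edge]; rewrite cardsD (setIidPr sA) cW => /eqP E; split=> //.
  have := subset_leq_card sA; rewrite cW => Aj.
  by rewrite -(subKn Aj) E addnK.
pose V A : {mpoly K[n]} := f A *: 'X_[mset (W :\: A)].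
have kdV B : kd V B = bdry f B *: 'X_[mset (W :\: B)].
  rewrite /kd /bdry scaler_suml; apply: eq_bigr => a aB.
  rewrite /V; case: (eqVneq (f (a |: B)) 0) => [->|].
    by rewrite mulr0 !scale0r mulr0.
  case/f_n0=> /subsetP sW _ _; rewrite -scalerAr -mulrA -mpolyXD -scalerA.
  have -> : (U_(a) + mset (W :\: (a |: B)))%MM = mset (W :\: B).
    apply/mnmP=> i; rewrite mnmDE mnm1E !msetE !inE (eq_sym i).
    by case: eqP => [<-|_]; rewrite // aB sW ?setU11.
  rewrite [RHS]scalerA [in RHS]mulrC -scalerA; congr (_ *: _).
  rewrite /ksign /sgn -signr_odd -[in RHS]signr_odd.
  by case: odd; rewrite ?expr0 ?expr1 ?mul1r ?scale1r ?mulN1r ?scaleN1r ?scalerN.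
have kV A : kext (fun a : kgens n m => V (val a)) A = V A.
  case: (boolP (#|A| == m)) => Am; first by rewrite -[A]/(val (Sub A Am : kgens n m)) kext_val.
  rewrite kext_out // /V [f A](_ : _ = 0) ?scale0r //; apply/eqP.
  by apply: contraNT Am => /f_n0[_ -> _].
have V_coef A be : (V A)@_be != 0 -> f A != 0 /\ be = mset (W :\: A).
  rewrite mcoeffZ mcoeffX; case: (mset _ =P be) => [<-|_]; last by rewrite mulr0 eqxx.
  by rewrite mulr1.
have [a||u [uch uE]] := tor (fun a => V (val a)).
- split.
    apply/edge_idealP => be /V_coef[/f_n0[sA cA edge] ->].
    by rewrite mvars_mset.
  apply/in_twist_coef => be /V_coef[/f_n0[sA cA edge] ->].
  by rewrite mdeg_mset cardsD (setIidPr sA) cA subnK // -cA subset_leq_card.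
- case: m kV {cW tor f_n0} => // m' kV b.
  by rewrite -kd_ext (eq_kd kV) kdV f0 scale0r.
exists (mpiece (kext u) (mset W)) => [A|A].
  rewrite /mpiece mvars_mset; case: (boolP (A \subset W)) => sA; last by rewrite eqxx.
  case: (boolP (#|A| == m.+1)) => Am; last by rewrite kext_out // mcoeff0 eqxx.
  rewrite -[A]/(val (Sub A Am : kgens n m.+1)) kext_val /= msetD // => nz.
  have [/edge_idealP/(_ _ nz)] := uch (Sub A Am); rewrite mvars_mset => edge _.
  by rewrite /slot sA edge cardsD (setIidPr sA) cW (eqP Am) addnS subSS addKn eqxx.
rewrite bdry_mpiece /mpiece mvars_mset.
case: (boolP (A \subset W)) => sA; last first.
  by apply/eqP; apply: contraNT sA => /f_n0[].
case: (boolP (#|A| == m)) => Am; last first.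
  rewrite kd_ext_out // mcoeff0; apply/eqP.
  by apply: contraNT Am => /f_n0[_ -> _].
rewrite -[A in kd _ A]/(val (Sub A Am : kgens n m)) kd_ext -uE /= /V.
by rewrite msetD // mcoeffZ mcoeffX eqxx mulr1.
Qed.

End TorEdgeIdeal.

(** * Dirac's theorem for the complement graph *)

Section Chordal.
Variables (T : finType) (e : rel T).
Hypotheses (e_sym : symmetric e) (e_irr : irreflexive e).
Implicit Types (a b c d u v w x y z : T) (C D W : {set T}).
Local Notation h := (nonadj e).

Lemma nonadj_irr : irreflexive h.
Proof. by move=> x; rewrite /nonadj eqxx. Qed.

Lemma nonadjE x y : x != y -> h x y = ~~ e x y.
Proof. by rewrite /nonadj => ->. Qed.

(** A path of minimal length has no chord, since a chord would skip the segment it spans. *)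
Lemma shortest_path (r : rel T) a b : connect r a b ->
  exists q, [/\ path r a q, last a q = b, uniq (a :: q) &
    forall i j, (i.+1 < j)%N -> (j <= size q)%N ->
      ~~ r (nth a (a :: q) i) (nth a (a :: q) j)].
Proof.
case/connectP=> p0 pth0 lst0.
pose P k := `[< exists q, [/\ path r a q, last a q = b & size q = k] >].
have exP : exists k, P k by exists (size p0); apply/asboolP; exists p0.
case: (ex_minnP exP) => k /asboolP[p [pth lst <-]] minp.
case/shortenP: pth lst => q pthq uq sq lstq.
have leq_pq : (size q <= size p)%N.
  by apply: uniq_leq_size; [case/andP: uq|exact: sq].
have min_q p' : path r a p' -> last a p' = b -> (size q <= size p')%N.
  move=> pth' lst'; apply: leq_trans leq_pq (minp _ _).
  by apply/asboolP; exists p'.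
exists q; split=> // i [//|j] ij jq; apply/negP => rij.
have iq : (i < size q)%N by apply: leq_trans jq; rewrite ltnW.
have take_last t : (t <= size q)%N -> last a (take t q) = nth a (a :: q) t.
  case: t => [|t] tq; first by rewrite take0.
  by rewrite (take_nth a) // last_rcons.
have path_drop t : (t <= size q)%N -> path r (nth a (a :: q) t) (drop t q).
  by move=> tq; rewrite -take_last //; move: pthq; rewrite -{1}(cat_take_drop t q) cat_path => /andP[].
have path_take t : path r a (take t q).
  by move: pthq; rewrite -{1}(cat_take_drop t q) cat_path => /andP[].
have dropE : drop j q = nth a (a :: q) j.+1 :: drop j.+1 q by rewrite (drop_nth a).
have := min_q (take i q ++ drop j q).
rewrite cat_path path_take last_cat take_last ?(ltnW iq) // dropE /= rij.
rewrite (path_drop j.+1 jq) => /(_ isT).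
have -> : last (nth a q j) (drop j.+1 q) = b.
  by rewrite -[nth a q j]/(nth a (a :: q) j.+1) -(take_last j.+1 jq) -last_cat cat_take_drop.
move=> /(_ erefl); rewrite size_cat /= size_take iq size_drop.
by move: ij jq; clear; lia.
Qed.

(* The shortest path from a to b through D closes up with v to an induced
   cycle of the complement. *)
Lemma hole_through v a b D : {in D, forall d, e v d} -> h v a -> h v b -> e a b ->
  connect (fun x y => [&& x \in a |: (b |: D), y \in a |: (b |: D) & h x y]) a b ->
  exists2 C, hole e C & C \subset v |: (a |: (b |: D)).
Proof.
move=> vD va vb ab; set D' := a |: _.
have nab : h a b = false by rewrite /nonadj ab andbF.
have h_sym := nonadj_sym e_sym.
have vD' : v \notin D'.
  rewrite !inE !negb_or; case/andP: va => -> _; case/andP: vb => -> _ /=.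
  by apply/negP => /vD; rewrite e_irr.
move=> /shortest_path[q [pth lst uq ind]].
have sD' x : x \in a :: q -> x \in D'.
  rewrite inE => /predU1P[->|]; first by rewrite setU11.
  have sub p c : path (fun x y => [&& x \in D', y \in D' & h x y]) c p ->
      x \in p -> x \in D'.
    elim: p c => // c' p IH c /= /andP[/and3P[_ c'D _] /IH pth'].
    by rewrite inE => /predU1P[->|/pth'].
  exact: sub pth.
pose s := a :: q; pose m := size q; pose pos x := index x s.
have bE : b = nth v s m by rewrite -lst (last_nth v).
have pos_le x : x \in s -> (pos x <= m)%N by rewrite -index_mem.
have posK x : x \in s -> nth v s (pos x) = x by move=> xs; rewrite nth_index.
have nth_a i : (i <= m)%N -> nth a s i = nth v s i by move=> im; apply: set_nth_default.
have h_far x y : x \in s -> y \in s -> h x y -> ~~ ((pos x).+1 < pos y)%N.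
  move=> xs ys xy; apply/negP => lt_xy.
  have := ind _ _ lt_xy (pos_le _ ys).
  rewrite !nth_a ?pos_le // !posK // xy !sD' //.
have pos_h x y : x \in s -> y \in s -> h x y -> pos x = (pos y).+1 \/ pos y = (pos x).+1.
  move=> xs ys xy; have := h_far _ _ xs ys xy.
  have := h_far _ _ ys xs; rewrite h_sym => /(_ xy).
  have : pos x != pos y.
    by apply: contraTneq xy => E; rewrite -(posK x) // E posK // nonadj_irr.
  by move: (pos x) (pos y) => px py; clear; lia.
have bs : b \in s by rewrite -lst mem_last.
have as_ : a \in s by rewrite mem_head.
have a_pos : pos a = 0%N by rewrite /pos /= eqxx.
have b_pos : pos b = m by rewrite bE /pos index_uniq // ltnS.
have hv x : x \in s -> h v x -> x = a \/ x = b.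
  move=> xs vx; move: (sD' x xs); rewrite !inE => /or3P[/eqP|/eqP|/vD]; [by left|by right|].
  by case/andP: vx => _ /negbTE ->.
have m_ge2 : (2 <= m)%N.
  rewrite ltnNge; apply/negP => m1.
  have: pos a != pos b by apply: contraFneq nab => E; move: ab; rewrite -(posK a) // E posK // e_irr.
  rewrite a_pos b_pos => m0; have m_1 : m = 1%N by case: (m) m1 m0 => [|[]].
  move: pth lst m_1; rewrite /m; case: (q) => [|c []] //= /andP[/and3P[_ _ ac] _] cb _.
  by rewrite -cb ac in nab.
have vs : v \notin s by apply: contra vD' => /sD'.
pose C := v |: [set x in s].
have inC x : x \in C -> x = v \/ x \in s by rewrite !inE => /predU1P.
exists C; last by apply/setUS/subsetP => x; rewrite inE => /sD'.
split.
- rewrite cardsU1 inE vs cardsE (card_uniqP uq) /= -/m; lia.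
- move=> x y z /inC xC /inC yC /inC zC xy yz; apply/negP => xz.
  case: xC xy xz => [->|xs] xy xz.
    case: yC xy yz => [->|ys]; first by rewrite nonadj_irr.
    case: zC xz => [->|zs]; first by rewrite nonadj_irr.
    by move=> /(hv _ zs) zE /(hv _ ys) yE; case: zE yE => -> [] ->;
      rewrite ?nonadj_irr ?nab // h_sym nab.
  case: yC xy yz => [->|ys] xy yz.
    case: zC yz xz => [->|zs]; first by rewrite nonadj_irr.
    move=> /(hv _ zs) zE; move: xy; rewrite h_sym => /(hv _ xs) xE.
    by case: zE xE => -> [] ->; rewrite ?nonadj_irr ?nab // h_sym nab.
  case: zC yz xz => [->|zs] yz xz.
    move: xz yz; rewrite ![h _ v]h_sym => /(hv _ xs) xE /(hv _ ys) yE.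
    by move: xy; case: xE yE => -> [] ->; rewrite ?nonadj_irr ?nab // h_sym nab.
  have := pos_h _ _ xs ys xy; have := pos_h _ _ ys zs yz; have := pos_h _ _ xs zs xz.
  by clear; lia.
- move=> x /inC[->|xs].
    apply: leq_trans (_ : #|[set a; b]| <= 2)%N; last by rewrite cards2; case: (_ != _).
    apply/subset_leq_card/subsetP => y; rewrite inE => /andP[/inC[->|ys]].
      by rewrite nonadj_irr.
    by case/(hv _ ys) => ->; rewrite !inE eqxx ?orbT.
  (* The two possible cyclic neighbours of [x] are its predecessor and successor. At [a] the
     predecessor is [v]; at [b] the successor is out of range and [nth] returns its default [v]. *)
  pose l := if pos x == 0%N then v else nth v s (pos x).-1.
  apply: leq_trans (_ : #|[set l; nth v s (pos x).+1]| <= 2)%N; last first.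
    by rewrite cards2; case: (_ != _).
  apply/subset_leq_card/subsetP => y; rewrite inE => /andP[/inC[->|ys] xy].
    move: xy; rewrite h_sym /l => /(hv _ xs)[] ->; rewrite !inE ?a_pos ?eqxx //.
    by rewrite b_pos [nth v s m.+1]nth_default ?eqxx ?orbT /=.
  case: (pos_h _ _ xs ys xy) => E; rewrite !inE /l.
    by rewrite E /= posK // eqxx.
  by rewrite -E posK // eqxx orbT.
(* The removed edge is [va]; what remains runs from [v] to [b] and back along [q] to [a]. *)
exists v, a; split=> //; [exact: setU11|by rewrite !inE eqxx orbT|].
set R := fun c d => _; have R_sym : connect_sym R.
  apply: sym_connect_sym => x y; rewrite /R (setUC [set x]) h_sym.
  by case: (x \in C); case: (y \in C).
have sC x : x \in s -> x \in C by move=> xs; rewrite inE [x \in [set _ in s]]inE xs orbT.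
apply: (@connect_trans _ _ b).
  apply: connect1; rewrite /R setU11 vb (sC b bs) /=.
  apply/eqP => /setP/(_ b); rewrite !inE eqxx orbT => /esym/orP[]/eqP E.
    by rewrite E nonadj_irr in vb.
  by rewrite E e_irr in ab.
rewrite R_sym; apply/connectP; exists q => //.
have sub c p : {subset c :: p <= s} -> path (fun x y => [&& x \in D', y \in D' & h x y]) c p ->
    path R c p.
  elim: p c => // d p IH c ss /= /andP[/and3P[_ _ cd] pp].
  rewrite IH // ?andbT => [|x xp]; last by apply: ss; rewrite inE xp orbT.
  have cs : c \in s by apply: ss; rewrite mem_head.
  have ds : d \in s by apply: ss; rewrite !inE eqxx orbT.
  rewrite /R !sC //= cd; apply: contra vs => /eqP/setP/(_ v).
  by rewrite !inE eqxx /= => /orP[]/eqP ->.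
exact: sub.
Qed.

Definition simplicial W s : Prop :=
  {in W &, forall y z, h s y -> h s z -> ~~ e y z}.

(* Dirac's argument: D is the component of u in the non-neighbourhood of v (in the
   complement), S its boundary, which is a clique of the complement. *)
Lemma exists_simplicial W v u : (forall C, hole e C -> ~~ (C \subset W)) ->
  v \in W -> u \in W -> e v u -> exists s, [/\ s \in W, e v s & simplicial W s].
Proof.
have h_sym := nonadj_sym e_sym.
have [m] := ubnP #|W|; elim: m W v u => // m IH W v u Wm noh vW uW vu.
pose N := [set y in W | e v y].
pose r x y := [&& x \in N, y \in N & h x y].
pose D := [set y | connect r u y].
pose S := [set x in W | h v x && [exists d in D, h x d]].
have uD : u \in D by rewrite inE connect0.
have r_sym : connect_sym r.
  by apply: sym_connect_sym => x y; rewrite /r h_sym andbCA.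
have DN x : x \in D -> x \in N.
  rewrite inE => /connectP[p]; elim/last_ind: p => [_ ->|p y _].
    by rewrite inE uW.
  by rewrite rcons_path last_rcons => /andP[_ /and3P[_ yN _]] ->.
have DW x : x \in D -> x \in W by move/DN; rewrite inE => /andP[].
have Dv x : x \in D -> e v x by move/DN; rewrite inE => /andP[].
have Dstep x y : x \in D -> y \in W -> e v y -> h x y -> y \in D.
  move=> xD yW vy xy; move: (xD); rewrite !inE => /connect_trans; apply.
  by apply: connect1; rewrite /r DN // inE yW vy.
(* Two vertices of [S] joined by an edge of [e] would be connected through [D] and form a hole with
   [v]. *)
have S_clique x y : x \in S -> y \in S -> ~~ e x y.
  rewrite !inE => /and3P[xW vx /exists_inP[d dD xd]] /and3P[yW vy /exists_inP[d' dD' yd]].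
  apply/negP => xy; have [|C hC sC] := @hole_through v x y D Dv vx vy xy.
    set E := x |: _; have inD z : z \in D -> z \in E by move=> zD; rewrite !in_setU1 zD !orbT.
    have xE : x \in E by rewrite !inE eqxx.
    have yE : y \in E by rewrite !inE eqxx orbT.
    apply: (@connect_trans _ _ d); first by apply: connect1; rewrite xE inD.
    apply: (@connect_trans _ _ d'); last first.
      by apply: connect1; rewrite yE inD //= h_sym.
    have : connect r d d'.
      by apply: (@connect_trans _ _ u); [rewrite r_sym|]; move: dD dD'; rewrite !inE.
    case/connectP => p pth ->; apply/connectP; exists p => //.
    elim: p d dD pth {xd} => //= c p IHp d dD /andP[/and3P[_ cN dc] pth].
    have cD : c \in D by move: cN; rewrite inE => /andP[cW vc]; apply: Dstep dc.
    by rewrite !inD //= dc IHp.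
  have /negP := noh _ hC; apply; apply: subset_trans sC _.
  by apply/subsetP=> z; rewrite !in_setU1 => /or4P[/eqP->|/eqP->|/eqP->|/DW].
pose X := D :|: S.
have XW : X \subset W by apply/subsetP=> z /setUP[/DW //|]; rewrite inE => /andP[].
have vX : v \notin X.
  rewrite inE negb_or !inE nonadj_irr andbF andbT; apply/negP => vD.
  by have := Dv v; rewrite inE vD e_irr => /(_ isT).
have Xm : (#|X| < m)%N.
  rewrite -ltnS; apply: leq_trans Wm; rewrite ltnS (cardsD1 v W) vW ltnS.
  by apply: subset_leq_card; rewrite subsetD1 XW vX.
have nohX C : hole e C -> ~~ (C \subset X).
  by move=> /noh; apply: contra => CX; apply: subset_trans XW.
(* Induction in [X] from a suitable edge yields [s] outside [S]: either [s] is [e]-adjacent to a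
   vertex of the clique [S], or no edge inside [X] meets [S]. If [X] has no edge at all, [u]
   serves. *)
have [s sD sX] : exists2 s, s \in D & simplicial X s.
  have in_D s : s \in X -> s \notin S -> s \in D by case/setUP=> // ->.
  have toX z : z \in D -> z \in X by move=> zD; rewrite inE zD.
  case: (boolP [exists w in S, exists t in X, e w t]) => [/exists_inP[w wS /exists_inP[t tX wt]]|noA].
    have wX : w \in X by rewrite inE wS orbT.
    have [s [sX ws ss]] := IH X w t Xm nohX wX tX wt.
    by exists s => //; apply: in_D => //; apply: contraL ws => /(S_clique _ _ wS).
  have nS w t : t \in X -> e w t -> w \notin S.
    move=> tX wt; apply: contra noA => wS.
    by apply/exists_inP; exists w => //; apply/exists_inP; exists t.
  case: (boolP [exists w in X, exists t in X, e w t]) => [/exists_inP[w wX /exists_inP[t tX wt]]|noB].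
    have [s [sX ws ss]] := IH X w t Xm nohX wX tX wt.
    by exists s => //; apply: in_D => //; apply: (nS s w) => //; rewrite e_sym.
  exists u => // y z yX zX _ _; apply: contra noB => yz.
  by apply/exists_inP; exists y => //; apply/exists_inP; exists z.
exists s; split; [exact: DW|exact: Dv|].
(* Within [W], complement edges leave [D] only into [S], so simplicial in [X] implies simplicial in
   [W]. *)
have nbrX y : y \in W -> h s y -> y \in X.
  move=> yW sy; rewrite inE; case: (boolP (e v y)) => vy; first by rewrite (Dstep s).
  apply/orP; right; rewrite inE yW /nonadj vy andbT andTb.
  apply/andP; split; last by apply/exists_inP; exists s => //; rewrite -/(h y s) h_sym.
  by apply: contraTneq sy => <-; rewrite h_sym /nonadj Dv // andbF.
by move=> y z yW zW sy sz; apply: sX => //; apply: nbrX.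
Qed.

(** The hypothesis says that no vertex of [W] is simplicial in the complement; [x0] provides the
    edge from which Dirac's theorem starts. *)
Lemma exists_hole W x0 : x0 \in W ->
  {in W, forall x, has_edge e [set y in W :\ x | ~~ e x y]} ->
  exists2 C, hole e C & C \subset W.
Proof.
move=> x0W nbr; apply: contrapT => noh.
have nohW C : hole e C -> ~~ (C \subset W).
  by move=> hC; apply/negP => CW; apply: noh; exists C.
have /has_edgeP[y [z [yN zN yz]]] := nbr _ x0W.
move: yN zN; rewrite !inE => /andP[/andP[_ yW] _] /andP[/andP[_ zW] _].
have [s [sW _ ss]] := exists_simplicial nohW yW zW yz.
have /has_edgeP[y' [z' []]] := nbr _ sW; rewrite !inE.
move=> /andP[/andP[ys y'W] sy] /andP[/andP[zs z'W] sz].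
by apply/negP/(ss y' z') => //; rewrite nonadjE // eq_sym.
Qed.

End Chordal.

(** * Degrees of the vertices of a hole *)

Section DegreeCount.
Variables (T : finType) (e : rel T).
Hypotheses (e_sym : symmetric e) (e_irr : irreflexive e).
Implicit Types (c w x y : T) (C W : {set T}).

Definition deg_in W x : nat := #|[set y in W | e x y]|.

Lemma deg_inS W W' x : W \subset W' -> (deg_in W x <= deg_in W' x)%N.
Proof.
move=> sW; apply/subset_leq_card/subsetP => y; rewrite !inE => /andP[yW ->].
by rewrite (subsetP sW).
Qed.

(** Besides itself, [c] misses at most its two cycle neighbours. *)
Lemma hole_degree C c : hole e C -> c \in C -> (#|C| <= deg_in C c + 3)%N.
Proof.
case=> _ _ le2 _ cC; rewrite -(cardsID [set y | e c y] C).
rewrite (_ : C :&: _ = [set y in C | e c y]); last by apply/setP=> y; rewrite !inE.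
rewrite leq_add2l (cardsD1 c) !inE cC e_irr /= add1n ltnS.
apply: leq_trans (le2 _ cC); apply/subset_leq_card/subsetP => y.
by rewrite !inE /nonadj eq_sym andbA andbC => /andP[-> /andP[-> ->]].
Qed.

(* Two complement-neighbours of w in C that are joined by an edge would form
   an induced 4-cycle of the complement together with w and y. *)
Lemma hole_missed C y w : (forall C', hole e C' -> (4 < #|C'|)%N) ->
  hole e C -> {in C, forall c, nonadj e y c} -> e y w ->
  (#|[set c in C | ~~ e w c]| <= 2)%N.
Proof.
move=> large hC yC yw; rewrite leqNgt; apply/negP.
case/card_gt2P => c1 [c2 [c3 [[]]]]; rewrite !inE.
move=> /andP[c1C wc1] /andP[c2C wc2] /andP[c3C wc3] [c12 c23 c31].
have wC c : c \in C -> ~~ e w c -> nonadj e w c.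
  move=> cC wc; rewrite /nonadj wc andbT; apply: contraTneq yw => ->.
  by have /andP[] := yC _ cC.
have h_sym := nonadj_sym e_sym.
have clique c d : c \in C -> d \in C -> ~~ e w c -> ~~ e w d -> c != d -> nonadj e c d.
  move=> cC dC wc wd cd; rewrite nonadjE //; apply/negP => ecd.
  have wE : {in [set w], forall x, e y x} by move=> _ /set1P ->.
  have [|C' hC'] := hole_through e_sym e_irr wE (yC _ cC) (yC _ dC) ecd.
    apply: (@connect_trans _ _ w); apply: connect1; rewrite !inE !eqxx !orbT /=.
      by rewrite h_sym wC.
    by rewrite wC.
  move/subset_leq_card; rewrite leqNgt => /negP; apply; apply: leq_trans (large _ hC').
  by rewrite ltnS !cardsU1 cards1; do 3!case: (_ \notin _).
case: hC => _ tri _ _; have := tri c1 c2 c3 c1C c2C c3C.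
by rewrite !clique // 1?eq_sym // => /(_ isT isT).
Qed.

(** Double counting of the edges between [C] and the neighbours of [y]: each such neighbour sees at
    least [#|C| - 2] vertices of [C], and none of them lies in the link. *)
Lemma sum_degree_link W C y : (forall C', hole e C' -> (4 < #|C'|)%N) ->
  hole e C -> C \subset [set u in W :\ y | ~~ e y u] ->
  (\sum_(c in C) deg_in [set u in W :\ y | ~~ e y u] c + deg_in W y * (#|C| - 2) <=
   \sum_(c in C) deg_in W c)%N.
Proof.
move=> large hC /subsetP CW.
have yC : {in C, forall c, nonadj e y c}.
  by move=> c /CW; rewrite !inE /nonadj eq_sym => /andP[/andP[-> _] ->].
pose N := [set u in W | e y u].
apply: leq_trans (_ : \sum_(c in C) (deg_in [set u in W :\ y | ~~ e y u] c +
                      \sum_(w in N) e w c) <= _)%N.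
  rewrite big_split leq_add2l exchange_big -sum_nat_const /=.
  apply: leq_sum => w; rewrite inE => /andP[_ yw].
  rewrite leq_subLR -(cardsID [set c | e w c] C) addnC; apply: leq_add.
    apply: leq_trans (hole_missed large hC yC yw).
    by apply/subset_leq_card/subsetP => c; rewrite !inE andbC.
  rewrite -sum1_card [X in (X <= _)%N]big_mkcond [X in (_ <= X)%N]big_mkcond.
  by apply: leq_sum => c _; rewrite in_setI in_set; case: (c \in C); case: (e w c).
apply: leq_sum => c cC.
have -> : (\sum_(w in N) e w c = #|[set w in N | e c w]|)%N.
  rewrite -sum1_card big_mkcond [RHS]big_mkcond; apply: eq_bigr => w _.
  by rewrite !inE (e_sym w c); case: (w \in W); case: (e y w); case: (e c w).
rewrite /deg_in -cardsUI [X in (_ + X)%N](_ : _ = 0%N).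
  rewrite addn0; apply/subset_leq_card/subsetP => w; rewrite !inE.
  by case: (w \in W); rewrite ?andbF //= => /orP[/andP[_ ->]|/andP[_ ->]].
apply/eqP; rewrite cards_eq0; apply/eqP/setP => w; rewrite !inE.
by case: (e y w); rewrite ?andbF.
Qed.

End DegreeCount.

(** * Exponential growth of the mean degree with regularity *)

Section RegularityGrowth.
Variables (R : realFieldType) (n : nat) (K : fieldType) (e : rel 'I_n) (k : nat).
Hypotheses (e_sym : symmetric e) (e_irr : irreflexive e) (k_gt0 : (0 < k)%N).
Hypothesis holes_large : forall C, hole e C -> (k + 4 <= #|C|)%N.
Implicit Types (W C : {set 'I_n}) (t r : nat).
Local Notation reg_le := (reg_le K e).

Lemma exists_critical W t : ~ reg_le W t ->
  exists W0, [/\ W0 \subset W, ~ reg_le W0 t & {in W0, forall x, reg_le (W0 :\ x) t}].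
Proof.
have [m] := ubnP #|W|; elim: m W => // m IH W Wm nW.
have [[x [xW nx]]|none] := pselect (exists x, x \in W /\ ~ reg_le (W :\ x) t).
  have [|W0 [sW0 nW0 crit]] := IH _ _ nx; first by rewrite (cardsD1 x) xW in Wm.
  by exists W0; split=> //; apply: subset_trans sW0 (subsetDl _ _).
exists W; split=> // x xW; apply: contrapT => nx; apply: none.
by exists x.
Qed.

(** In a critical subgraph the non-neighbours of each vertex span an edge, since otherwise
    [reg_le_step] would bound the regularity. *)
Lemma exists_hole_reg W : ~ reg_le W 2 -> exists2 C, hole e C & C \subset W.
Proof.
move=> /exists_critical[W0 [sW0 nW0 crit]].
case: (set_0Vmem W0) => [W00|[x0 x0W]].
  by case: nW0; rewrite W00; apply: reg_le_edgeless; apply/has_edgeP => -[x [y []]]; rewrite inE.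
have [x xW|C hC CW0] := exists_hole e_sym e_irr x0W; last first.
  by exists C => //; apply: subset_trans sW0.
apply: contraPT nW0 => noedge; apply.
by apply: (reg_le_step e_sym e_irr _ xW) => //; [exact: crit|exact: reg_le_edgeless].
Qed.

(** A vertex of a hole [C] has degree at least [#|C| - 3], hence the initial [k + 1]; each unit of
    regularity contributes a factor [(k + 4) / 2]. *)
Definition growth r : R := (k%:R + 1) * ((k%:R + 4) / 2) ^+ r.

(* Take W minimal and let C be a hole of maximal mean degree M; some y in C has
   degree >= M. A hole C' provided by induction away from N[y] misses each
   neighbour of y at most twice, so its mean degree is at least
   growth r + M (1 - 2 / (k + 4)), and at most M by the choice of C. *)
Lemma reg_growth r W : ~ reg_le W (r + 2) -> exists C, [/\ hole e C, C \subset W &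
  growth r * #|C|%:R <= (\sum_(c in C) deg_in e W c)%:R].
Proof.
have hole_ex t W' : ~ reg_le W' (t + 2) -> exists2 C, hole e C & C \subset W'.
  by move=> nW; apply: exists_hole_reg => rW; apply: nW; apply: reg_leW rW; rewrite leq_addl.
have hole_size C : hole e C -> 4 + k%:R <= #|C|%:R :> R.
  by move=> /holes_large; rewrite -(ler_nat R) natrD addrC.
have k0 : 0 <= k%:R :> R by apply: ler0n.
elim: r W => [|r IH] W nW.
  have [C hC CW] := hole_ex _ _ nW; exists C; split=> //.
  rewrite /growth expr0 mulr1 -[1]/(1%:R) -natrD -natrM ler_nat mulnC -sum_nat_const.
  apply: leq_sum => c cC; apply: leq_trans (deg_inS e c CW).
  by have := hole_degree e_irr hC cC; have := holes_large hC; clear; lia.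
have [W0 [sW0 nW0 crit]] := exists_critical nW.
(* By criticality the bound holds after deleting [y], so it must fail, one lower, on the
   non-neighbours of [y]. *)
have link y : y \in W0 -> exists C, [/\ hole e C, C \subset [set u in W0 :\ y | ~~ e y u] &
    growth r * #|C|%:R <= (\sum_(c in C) deg_in e [set u in W0 :\ y | ~~ e y u] c)%:R].
  move=> yW; apply: IH => lk; apply: nW0.
  apply: (reg_le_step e_sym e_irr _ yW); [by rewrite addSn addn2|exact: crit|].
  by rewrite addSn.
have [C0 hC0 C0W] := hole_ex _ _ nW0.
pose M C : R := (\sum_(c in C) deg_in e W0 c)%:R / #|C|%:R.
pose P C := `[< hole e C >] && (C \subset W0).
have P0 : P C0 by rewrite /P C0W andbT; apply/asboolP.
case: (arg_maxP M P0) => C /andP[/asboolP hC CW] maxC.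
have C_gt0 C' : hole e C' -> 0 < #|C'|%:R :> R.
  by move/hole_size; lra.
exists C; split=> //; first exact: subset_trans sW0.
suff: growth r.+1 <= M C.
  rewrite /M ler_pdivlMr ?C_gt0 // => /le_trans; apply.
  by rewrite ler_nat; apply: leq_sum => c _; apply: deg_inS.
have [y yC degy] : exists2 y, y \in C & M C <= (deg_in e W0 y)%:R.
  apply/exists_inP; apply: contraT => /exists_inPn small.
  have /set0Pn[y0 y0C] : C != set0 by rewrite -card_gt0 -(ltr0n R) C_gt0.
  have : (\sum_(c in C) deg_in e W0 c)%:R < \sum_(c in C) M C.
    rewrite natr_sum; apply: ltr_sum; first by apply/hasP; exists y0; rewrite ?mem_index_enum.
    by move=> c /small; rewrite -ltNge.
  by rewrite sumr_const -[M C *+ _]mulr_natr /M divfK ?ltxx // gt_eqF ?C_gt0.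
have [C' [hC' C'lk growC']] := link y (subsetP CW _ yC).
have C'W : C' \subset W0.
  by apply: subset_trans C'lk _; apply/subsetP => u; rewrite !inE => /andP[/andP[]].
(* This is where [0 < k] enters: it excludes holes of length 4. *)
have large C1 : hole e C1 -> (4 < #|C1|)%N.
  by move/holes_large; apply: leq_trans; move: k_gt0; clear; lia.
have := sum_degree_link e_sym e_irr large hC' C'lk.
rewrite -(ler_nat R) natrD natrM => sumC'.
have : M C' <= M C by apply: maxC; rewrite /P C'W andbT; apply/asboolP.
rewrite {1}/M ler_pdivrMr ?C_gt0 // => MC'.
have C'4 := hole_size _ hC'.
rewrite natrB in sumC'; last by case: hC' => /(leq_trans _) ->.
have M0 : 0 <= M C by rewrite divr_ge0 ?ler0n.
have g0 : 0 <= growth r by rewrite mulr_ge0 ?exprn_ge0 //; lra.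
have -> : growth r.+1 = (k%:R + 4) / 2 * growth r by rewrite /growth exprS mulrCA.
(* With [deg y >= M C], the terms [M C * #|C'|] on both sides cancel, leaving the 2 from the missed
   vertices. *)
have gc : growth r * #|C'|%:R <= 2 * M C by nra.
have : growth r * (4 + k%:R) <= growth r * #|C'|%:R by rewrite ler_wpM2l.
lra.
Qed.

End RegularityGrowth.

(** * Existence of the regularity and the degree bound *)

Section EdgeIdealRegularity.
Variables (K : fieldType) (T : finType) (e : rel T).
Hypotheses (e_sym : symmetric e) (e_irr : irreflexive e).
Local Notation n := #|T|.
Implicit Types (W C : {set 'I_n}) (i j : 'I_n).
Local Notation er := (ord_edge e).

Lemma ord_edge_sym : symmetric er.
Proof. by move=> i j; rewrite /ord_edge /= e_sym. Qed.

Lemma ord_edge_irr : irreflexive er.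
Proof. by move=> i; rewrite /ord_edge /= e_irr. Qed.

Lemma deg_in_max W i : (deg_in er W i <= max_degree e)%N.
Proof.
apply: leq_trans (leq_bigmax (enum_val i)); rewrite /deg_in.
rewrite -(card_imset _ enum_val_inj); apply/subset_leq_card/subsetP => y.
by case/imsetP => j; rewrite !inE => /andP[_ ij] ->.
Qed.

(** The class of the hole has homological degree [#|C| - 3] and internal degree [#|C|], one off the
    linear strand. *)
Lemma hole_linear_card k C : k_steps_linear K e k -> hole er C -> (k + 4 <= #|C|)%N.
Proof.
move=> lin hC; rewrite leqNgt; apply/negP => Ck.
have C4 : (4 <= #|C|)%N by case: hC.
have CE : #|C| = (#|C| - 3 + 3)%N by rewrite subnK // ltnW.
apply: (hole_not_exact (K := K) ord_edge_sym ord_edge_irr hC).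
apply: (exact_Tor_zero e_irr CE); apply: lin; move: C4 Ck; clear; lia.
Qed.

Lemma exact_at_card W (P : pred {set 'I_n}) s : (#|W| <= s)%N -> exact_at K W P s.
Proof.
move=> Ws f fs _; exists (fun=> 0) => [A|A]; first by rewrite eqxx.
rewrite bdry0; apply: contraTeq Ws => /fs/and3P[_ _ /eqP sE].
by rewrite -ltnNge -sE subset_leq_card // subsetDl.
Qed.

(** This class is the generator x_i x_j of the ideal: a primitive would need a one-vertex set
    containing an edge. *)
Lemma edge_not_exact i j : er i j -> ~ exact_at K [set i; j] (has_edge er) 1.
Proof.
move=> ij ex; have ij' : i != j by apply: contraTneq ij => ->; rewrite ord_edge_irr.
have [A|B|g gs fE] := ex (fun A => (A == set0)%:R).
- case: (eqVneq A set0) => [-> _|]; last by rewrite eqxx.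
  rewrite /slot sub0set setD0 cards2 ij' /= andbT.
  by apply/has_edgeP; exists i, j; rewrite !inE !eqxx orbT.
- rewrite /bdry big1 // => a _; rewrite (_ : (a |: B == set0) = false) ?mulr0 //.
  by apply/negbTE/set0Pn; exists a; rewrite setU11.
have := fE set0; rewrite eqxx => /eqP; apply/negP.
rewrite /bdry big1 ?oner_eq0 // => a _; apply/eqP; rewrite mulf_eq0 orbC.
apply/orP; left; apply: contraT => /gs/and3P[_].
case/has_edgeP => x [y [xF yF xy]] /cards1P[z Fz]; move: xF yF xy; rewrite Fz.
by move=> /set1P -> /set1P ->; rewrite ord_edge_irr.
Qed.

Lemma exists_regularity : (exists x y, e x y) -> exists s,
  [/\ (0 < s)%N, is_regularity (edge_ideal (K := K) e) s.+1%:Z &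
      exists W, ~ exact_at K W (has_edge er) s].
Proof.
case=> x [y xy]; pose P s := `[< exists W, ~ exact_at K W (has_edge er) s >].
have P1 : P 1%N.
  apply/asboolP; exists [set enum_rank x; enum_rank y]; apply: edge_not_exact.
  by rewrite /ord_edge /= !enum_rankK.
have Pbound s : P s -> (s <= n)%N.
  move=> /asboolP[W nW]; rewrite leqNgt; apply/negP => ns; apply: nW.
  apply: exact_at_card; apply: leq_trans (ltnW ns).
  by rewrite -[X in (_ <= X)%N]card_ord max_card.
case: (ex_maxnP (ex_intro (fun s => P s) _ P1) Pbound) => s /asboolP[W nW] max_s.
exists s; split; [exact: max_s|split|by exists W].
  have sW : (s.+1 <= #|W|)%N.
    by rewrite ltnNge; apply/negP => Ws; apply: nW; apply: exact_at_card.
  exists (#|W| - s.+1)%N, #|W|; split; last by lia.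
  by move=> /(exact_Tor_zero e_irr (esym (subnK sW))).
(* Truncated subtraction is harmless: for [j <= m] the required bound is immediate. *)
move=> m j nT; suff : (j - m.+1 <= s)%N by lia.
apply: max_s; apply/asboolP; apply: contrapT => none; apply: nT.
apply: (Tor_zero_exact e_irr) => W' W'j; apply: contrapT => nW'.
by apply: none; exists W'.
Qed.

Lemma max_degree_growth (R : realFieldType) k r W : (0 < k)%N -> k_steps_linear K e k ->
  ~ reg_le K er W (r + 2) -> growth R k r <= (max_degree e)%:R.
Proof.
move=> k0 lin nW.
have [C [hC _]] := reg_growth R ord_edge_sym ord_edge_irr k0 (fun C => hole_linear_card lin) nW.
have C0 : 0 < #|C|%:R :> R by rewrite ltr0n; case: hC => /(leq_trans _) ->.
rewrite -ler_pdivlMr // => /le_trans; apply; rewrite ler_pdivrMr // -natrM ler_nat.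
by rewrite mulnC -sum_nat_const; apply: leq_sum => c _; apply: deg_in_max.
Qed.

End EdgeIdealRegularity.

(* Passage to logarithms and conclusion *)
From mathcomp Require Import all_classical all_reals all_analysis.

Lemma le_log (R : realType) (q x : R) t u : 1 < q -> 0 < x ->
  q ^+ t <= q ^+ u * x -> t%:R <= u%:R + ln x / ln q.
Proof.
move=> q1 x0; have q0 : 0 < q by apply: lt_trans q1.
rewrite -ler_ln ?posrE ?mulr_gt0 ?exprn_gt0 // lnM ?posrE ?exprn_gt0 // !lnXn //.
by move=> h; rewrite -(ler_pM2r (ln_gt0 q1)) mulrDl divfK ?gt_eqF ?ln_gt0 // !mulr_natl.
Qed.

(* The bound fails when the graph is a single edge (plus isolated vertices) and
   k >= 3: then I(G) = (xy) is k-steps linear for all k and has regularity 2,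
   while log_{7/2}(1/4) + 3 < 2 already for k = 3.  As d >= 1, [kd] excludes
   exactly the cases d = 1, k >= 3. *)
Theorem theorem4p1 (R : realType) (K : fieldType) (T : finType) (e : rel T)
    (e_sym : symmetric e) (e_irr : irreflexive e)
    (e_edge : exists x y : T, e x y)
    (k : nat) (k_gt0 : (1 <= k)%N)
    (kd : (k <= 2)%N \/ (2 <= max_degree e)%N)
    (e_lin : k_steps_linear K e k) :
  exists r : int,
    is_regularity (edge_ideal (K := K) e) r /\
    r%:~R <= ln ((max_degree e)%:R / (k%:R + 1)) / ln ((k%:R + 4) / 2) + 3 :> R.
Proof.
have [s [s_gt0 regI [W nW]]] := exists_regularity K e_irr e_edge.
exists s.+1%:Z; split=> //; rewrite -pmulrn.
have k0 : 0 <= k%:R :> R by apply: ler0n.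
have d1 : (1 <= max_degree e)%N.
  case: e_edge => x [y xy]; apply: leq_trans (leq_bigmax x).
  by rewrite card_gt0; apply/set0Pn; exists y; rewrite inE.
have d0 : 0 < (max_degree e)%:R :> R by rewrite ltr0n.
have q1 : 1 < (k%:R + 4) / 2 :> R by lra.
have x0 : 0 < (max_degree e)%:R / (k%:R + 1) :> R by rewrite divr_gt0 //; lra.
case: s s_gt0 regI nW => [//|[|r]] _ _ nW.
  (* Regularity 2: the claim amounts to [k + 1 <= d (k + 4) / 2], which holds for [d >= 1] if
     [k <= 2], and for all [k] if [d >= 2]. *)
  suff : 0%:R <= 1%:R + ln ((max_degree e)%:R / (k%:R + 1)) / ln ((k%:R + 4) / 2) :> R by lra.
  apply: le_log => //; rewrite expr0 expr1 mulrA ler_pdivlMr; last by lra.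
  case: kd => [k2|d2].
    have k2' : k%:R <= 2 :> R by rewrite (ler_nat R k 2).
    have d1' : 1 <= (max_degree e)%:R :> R by rewrite (ler_nat R 1).
    nra.
  have d2' : 2 <= (max_degree e)%:R :> R by rewrite (ler_nat R 2).
  nra.
(* Regularity [r + 3]: the growth bound reads [((k + 4) / 2) ^ r <= d / (k + 1)], so [r] is at most
   the logarithm. *)
have : ~ reg_le K (ord_edge e) W (r + 2) by move=> /(_ r.+2); rewrite addn2 => /(_ (leqnn _)).
move=> /(max_degree_growth e_sym e_irr R k_gt0 e_lin); rewrite /growth => large.
suff : r%:R <= 0%:R + ln ((max_degree e)%:R / (k%:R + 1)) / ln ((k%:R + 4) / 2) :> R.
  by rewrite add0r -[r.+3]addn3 natrD; lra.
by apply: le_log; rewrite // expr0 mul1r ler_pdivlMr 1?mulrC //; lra.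
Qed.
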